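(* Let $s>0$ and suppose $\phi \in \Phi$. Set $\alpha := \mathbb{E}\, H_2(G(\mathcal{P}_s,\phi))$. Then $$d_{TV}\big( \mathcal{L}(H_2(G(\mathcal{P}_s,\phi))), \mathcal{L}(Z_\alpha) \big) \leq (1 \wedge \alpha^{-1} ) \int_{\mathbb{X}} \left( \int_{\mathbb{X}} \phi(x,y)\, s\, \mu(dy) \right)^2 s\, \mu(dx).$$
   Context: $(\mathbb{X},\mathcal{F},\mu)$ is an arbitrary probability space. $\Phi$ is the class of all measurable symmetric functions $\phi:\mathbb{X}\times\mathbb{X}\to[0,1]$. Let $X_1,X_2,\ldots$ be independent random elements of $\mathbb{X}$ with common distribution $\mu$. For real $s>0$, $\mathcal{P}_s$ is the Poisson point process $\{X_1,\ldots,X_{N}\}$, where $N$ is Poisson with mean $s$, independent of $(X_i)$; it has mean measure $s\mu$. (Points are counted with multiplicity, i.e. vertices are distinguished by their index $i$.) $G(\mathcal{P}_s,\phi)$ is the random undirected graph with vertex set $\mathcal{P}_s$ in which, conditionally on $\mathcal{P}_s$, each pair $\{x,y\}$ of points of $\mathcal{P}_s$ is joined by an edge with probability $\phi(x,y)$, independently of all other pairs. $H_2(G)$ is the number of edges of a graph $G$. $\mathcal{L}(\cdot)$ denotes the law of a random variable. $Z_\alpha$ is a Poisson random variable with parameter $\alpha$. $a\wedge b=\min(a,b)$. In the degenerate case $\alpha=0$, $Z_0:=0$ and $1\wedge 0^{-1}:=1$. For $\mathbb{N}_0$-valued random variables $X,Y$, $d_{TV}(\mathcal{L}(X),\mathcal{L}(Y))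 = \sup_{A\subset\mathbb{N}_0}(\mathbb{P}[X\in A]-\mathbb{P}[Y\in A])$. *)

(* Defs.v *)
Set Warnings "-notation-overridden,-ambiguous-paths,-notation-incompatible-prefix".
From HB Require Import structures.
From mathcomp Require Import all_boot all_order all_algebra.
From mathcomp Require Import all_classical all_reals all_analysis.

Set Implicit Arguments.
Unset Strict Implicit.
Unset Printing Implicit Defensive.

Import Order.TTheory GRing.Theory Num.Theory.

Local Open Scope classical_set_scope.
Local Open Scope ring_scope.

Definition connection_function {R : realType} {d} {T : measurableType d}
    (phi : T * T -> R) : Prop :=
  [/\ measurable_fun [set: T * T] phi,
      forall x y, phi (x, y) = phi (y, x)
    & forall x y, 0 <= phi (x, y) <= 1].

Definition mutually_independent {R : realType} {d} {T : measurableType d}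
    (P : probability T R) {I : eqType} (F : I -> set_system T) : Prop :=
  forall (J : seq I) (A : I -> set T), uniq J ->
    (forall i, i \in J -> F i (A i)) ->
    P (\big[setI/[set: T]]_(i <- J) A i) = \big[*%E/1%E]_(i <- J) P (A i).

(* A realisation of G(P_s, phi) on the probability space (Om, P).  The points
   are rg_point 0, ..., rg_point (rg_size - 1), so that vertices are told apart
   by their index even when points coincide; rg_adj i j is the indicator of the
   edge {i, j}, and only its values for i, j < rg_size matter.

   rg_adj_law is the conditional law of the edges given the point process: on
   the event rg_size = n, conditionally on the points, the edge indicators of
   the pairs i < j < n are independent Bernoulli variables with parameters
   phi(X_i, X_j).  It is stated in integrated form against every event that the
   n points determine. *)
Record random_graph {R : realType} {d} {T : measurableType d}
    (mu : probability T R) (s : R) (phi : T * T -> R)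
    {dOm} {Om : measurableType dOm} (P : probability Om R) := RandomGraph {
  rg_size : {RV P >-> nat} ;
  rg_point : nat -> {RV P >-> T} ;
  rg_adj : nat -> nat -> {RV P >-> bool} ;
  (* The second argument of poisson_prob is a dummy. *)
  rg_size_law : forall A : set nat,
    distribution P rg_size A = poisson_prob s 0 A ;
  rg_point_law : forall i (A : set T), measurable A ->
    distribution P (rg_point i) A = mu A ;
  rg_indep : mutually_independent P (fun o : option nat =>
    if o is Some i then preimage_set_system [set: Om] (rg_point i) measurable
    else preimage_set_system [set: Om] rg_size measurable) ;
  rg_adj_sym : forall i j w, rg_adj i j w = rg_adj j i w ;
  rg_adj_irr : forall i w, rg_adj i i w = false ;
  rg_adj_law : forall (n : nat) (A : set (n.-tuple T)) (e : 'I_n -> 'I_n -> bool),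
    measurable A ->
    let D := [set w | rg_size w = n /\ A [tuple rg_point i w | i < n]] in
    P (D `&` [set w | forall i j : 'I_n, (i < j)%N -> rg_adj i j w = e i j]) =
    (\int[P]_(w in D)
      (\prod_(i < n) \prod_(j < n | (i < j)%N)
        bernoulli_pmf (phi (rg_point i w, rg_point j w)) (e i j))%:E)%E
}.

(* Each edge {i, j} is counted once, through its ordering i < j. *)
Definition num_edges n (e : rel 'I_n) : nat :=
  #|[pred p : 'I_n * 'I_n | (p.1 < p.2)%N && e p.1 p.2]|.

Definition H2 {R : realType} {d} {T : measurableType d}
    {mu : probability T R} {s : R} {phi : T * T -> R}
    {dOm} {Om : measurableType dOm} {P : probability Om R}
    (G : random_graph mu s phi P) (w : Om) : nat :=
  num_edges (fun i j : 'I_(rg_size G w) => rg_adj G i j w).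

Section measurable_H2.
Context {R : realType} {d} {T : measurableType d}.
Context {mu : probability T R} {s : R} {phi : T * T -> R}.
Context {dOm} {Om : measurableType dOm} {P : probability Om R}.
Variable G : random_graph mu s phi P.

Lemma measurable_num_edges n :
  measurable_fun [set: Om] (fun w => num_edges (fun i j : 'I_n => rg_adj G i j w)).
Proof.
move=> _ B _; rewrite setTI.
have -> : (fun w => num_edges (fun i j : 'I_n => rg_adj G i j w)) @^-1` B =
    \bigcup_(e in [set e : {ffun 'I_n * 'I_n -> bool} |
                     B (num_edges (fun i j => e (i, j)))])
    \bigcap_(p in [set: 'I_n * 'I_n]) (rg_adj G p.1 p.2 @^-1` [set e p]).
  apply/seteqP; split=> [w Bw | w [e Be we]].
    exists [ffun p : 'I_n * 'I_n => rg_adj G p.1 p.2 w].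
      rewrite /=; move: Bw => /=; congr (B _).
      by apply: eq_card => p; rewrite !inE ffunE.
    by move=> p _ /=; rewrite ffunE.
  rewrite /=; move: Be => /=; congr (B _).
  by apply: eq_card => -[i j]; rewrite !inE/= -(we (i, j) I).
apply: fin_bigcup_measurable => [|e _]; first exact: finite_finset.
apply: fin_bigcap_measurable => [|p _]; first exact: finite_finset.
by rewrite -[X in measurable X]setTI; exact: (measurable_funPT (rg_adj G p.1 p.2)).
Qed.

Lemma measurable_H2 : measurable_fun [set: Om] (H2 G).
Proof.
move=> _ B _; rewrite setTI.
have -> : H2 G @^-1` B = \bigcup_n (rg_size G @^-1` [set n] `&`
    (fun w => num_edges (fun i j : 'I_n => rg_adj G i j w)) @^-1` B).
  apply/seteqP; split=> [w Bw | w [n _] /= []]; first by exists (rg_size G w).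
  by rewrite /H2 => ->.
apply: bigcup_measurable => n _; apply: measurableI.
  by rewrite -[X in measurable X]setTI; exact: (measurable_funPT (rg_size G)).
by rewrite -[X in measurable X]setTI; exact: (@measurable_num_edges n).
Qed.

HB.instance Definition _ :=
  isMeasurableFun.Build _ _ _ _ (H2 G) measurable_H2.

End measurable_H2.

Definition dTV {R : realType} (p q : probability nat R) : \bar R :=
  ereal_sup [set (p A - q A)%E | A in [set: set nat]].

(* min(1, 1/a), with the convention that it is 1 at a = 0 (where a^-1 = 0). *)
Definition min1V {R : realType} (a : R) : R :=
  if a == 0 then 1 else Num.min 1 a^-1.

(* Main.v *)
(* Stein-Chen method. Let f solve alpha f(m+1) - m f(m) = 1_A(m) - Po(alpha)(A).
   Conditionally on N = n the edges are independent given the points, so size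
   biasing turns E[W f(W)] into a sum over pairs k = {i, j} of
   E[phi(X_i, X_j) f(1 + W_k)], where W_k counts the edges other than k. Dropping
   from W_k the edges that meet k leaves a variable independent of (X_i, X_j)
   and distributed as the number of edges on n - 2 vertices; the price is at most
   sup(f(m+1) - f(m+2)) <= min(1, 1/alpha) times the expected number of dropped
   edges. Since binom(n, 2) Po(s)(n) = (s^2 / 2) Po(s)(n - 2), summing over n
   makes the main terms telescope, and the errors add up to
   s^3 int (int phi(x, y) mu(dy))^2 mu(dx). Only sums over n < M are used, and
   the remainder is controlled by P(N >= M). *)

Require Import Defs.
From HB Require Import structures.
From mathcomp Require Import all_boot all_order all_algebra.
From mathcomp Require Import all_classical all_reals all_analysis.
From mathcomp Require Import measurable_realfun.
From mathcomp Require Import zify ring lra.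

Set Implicit Arguments.
Unset Strict Implicit.
Unset Printing Implicit Defensive.

Import Order.TTheory GRing.Theory Num.Theory.
Import numFieldNormedType.Exports.

Local Open Scope classical_set_scope.
Local Open Scope ring_scope.
(** * Sums of independent Bernoulli variables *)

(** Fixing the number of points and their positions makes the edges independent, and every mean
    becomes the finite recursion [bern] integrated over finitely many points; the Poisson size is
    averaged last. One-sided bounds suffice: total variation is a supremum over all events, and
    omitting edges only lowers the count, so only an upper bound on [f m.+1 - f m.+2] enters. It is
    [(1 - exp (- alpha)) / alpha], which is at most 1 and at most [1 / alpha]. The power of [s]: an
    edge on [n] vertices meets [2 * (n - 2)] other possible edges, so the factor [s ^+ 2 / 2] is
    multiplied by twice the Poisson mean [s]. Truncation leaves two boundary terms of the
    telescoping sum; any bound on [f] uniform in its argument makes them vanish with the Poisson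
    tail. The case [alpha = 0], where the Stein equation cannot be solved by dividing by [alpha], is
    settled by a first moment bound. *)

Section bern.
Context {R : realFieldType}.

(* Mean of [h (S)] where [S] is a sum of independent Bernoulli variables with
   parameters [p k], [k] in [r]. *)
Fixpoint bern {K : Type} (p : K -> R) (r : seq K) (h : nat -> R) : R :=
  if r is k :: r' then
    p k * bern p r' (fun m => h m.+1) + (1 - p k) * bern p r' h
  else h 0%N.

Lemma bern_map {K L : Type} (g : L -> K) (p : K -> R) (r : seq L) h :
  bern p (map g r) h = bern (p \o g) r h.
Proof. by elim: r h => //= l r IH h; rewrite !IH. Qed.

Lemma eq_bern {K : eqType} (p q : K -> R) (r : seq K) h :
  {in r, p =1 q} -> bern p r h = bern q r h.
Proof.
elim: r h => //= k r IH h pq; rewrite pq ?mem_head// !IH// => l lr;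
  by rewrite pq// inE lr orbT.
Qed.

Lemma bern_cst {K : Type} (p : K -> R) (r : seq K) c : bern p r (fun=> c) = c.
Proof. by elim: r => //= k r ->; rewrite -mulrDl addrC subrK mul1r. Qed.

Lemma bernD {K : Type} (p : K -> R) (r : seq K) h g :
  bern p r (fun m => h m + g m) = bern p r h + bern p r g.
Proof. by elim: r h g => //= k r IH h g; rewrite !IH; ring. Qed.

Lemma bernZ {K : Type} (p : K -> R) (r : seq K) c h :
  bern p r (fun m => c * h m) = c * bern p r h.
Proof. by elim: r h => //= k r IH h; rewrite !IH; ring. Qed.

Lemma le_bern {K : Type} (p : K -> R) (r : seq K) h g :
  (forall k, 0 <= p k <= 1) -> (forall m, h m <= g m) ->
  bern p r h <= bern p r g.
Proof.
move=> p01; elim: r h g => //= k r IH h g hg; have /andP[p0 p1] := p01 k.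
by apply: lerD; rewrite ler_wpM2l ?IH ?subr_ge0.
Qed.

Lemma bern_ge0 {K : Type} (p : K -> R) (r : seq K) h :
  (forall k, 0 <= p k <= 1) -> (forall m, 0 <= h m) -> 0 <= bern p r h.
Proof. by move=> p01 h0; rewrite -(bern_cst p r 0) le_bern. Qed.

(** Write the sum as a sum of indicators: when indicator [k] is 1, the rest is, by independence, the
    sum over the other indices. The recursion of [bern] splits off one indicator at a time. *)
Lemma bern_size_bias {K : eqType} (p : K -> R) (r : seq K) h : uniq r ->
  bern p r (fun m => m%:R * h m) =
  \sum_(k <- r) p k * bern p [seq l <- r | l != k] (fun m => h m.+1).
Proof.
elim: r h => [|k r IH] h /=; first by rewrite big_nil mul0r.
move=> /andP[kr ur]; rewrite big_cons eqxx/=.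
have -> : [seq l <- r | l != k] = r.
  by apply/all_filterP/allP => l lr; apply: contraNneq kr => <-.
have -> : bern p r (fun m => m.+1%:R * h m.+1) =
    bern p r (fun m => h m.+1) + bern p r (fun m => m%:R * h m.+1).
  by rewrite -bernD; congr bern; apply/funext => m; rewrite -natr1; ring.
rewrite (IH (fun m => h m.+1))// (IH h)// mulrDr -addrA; congr +%R.
rewrite !mulr_sumr -big_split/=; apply: eq_big_seq => l lr.
have -> /= : k != l by apply: contraNneq kr => ->.
by ring.
Qed.

(** Restoring an omitted indicator [k] raises the count by one with probability [p k], and each such
    step costs at most [c]. *)
Lemma bern_filter_le {K : eqType} (p : K -> R) (a : pred K) (r : seq K) h c :
  (forall k, 0 <= p k <= 1) -> (forall m, h m <= h m.+1 + c) ->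
  bern p [seq k <- r | a k] h <= bern p r h + c * \sum_(k <- r | ~~ a k) p k.
Proof.
move=> p01; elim: r h => [|k r IH] h hc /=; first by rewrite big_nil mulr0 addr0.
have /andP[p0 p1] := p01 k; rewrite big_cons.
case: (a k) => /=.
  have := ler_wpM2l p0 (IH (fun m => h m.+1) (fun m => hc m.+1)).
  have p1' : 0 <= 1 - p k by rewrite subr_ge0.
  have := ler_wpM2l p1' (IH h hc); lra.
apply: (le_trans (IH h hc)).
have : bern p r h <= bern p r (fun m => h m.+1 + c) by exact: le_bern.
rewrite bernD bern_cst => /(ler_wpM2l p0); lra.
Qed.

End bern.

(** * Pairs of vertices, listed so that [bern] can recurse over them *)

Fixpoint pairs {K : Type} (v : seq K) : seq (K * K) :=
  if v is x :: v' then [seq (x, y) | y <- v'] ++ pairs v' else [::].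

Lemma pairs_map {K L : Type} (g : L -> K) (v : seq L) :
  pairs (map g v) = [seq (g k.1, g k.2) | k <- pairs v].
Proof.
elim: v => //= x v ->; rewrite map_cat -!map_comp; congr cat.
Qed.

Lemma size_pairs {K : Type} (v : seq K) : size (pairs v) = 'C(size v, 2).
Proof.
by elim: v => //= x v IH; rewrite size_cat size_map IH binS bin1 addnC.
Qed.

(** With [a] the property of lying off a given edge, the edges disjoint from it are all the pairs of
    the remaining vertices. *)
Lemma filter_pairs {K : Type} (a : pred K) (v : seq K) :
  [seq k <- pairs v | a k.1 && a k.2] = pairs [seq x <- v | a x].
Proof.
elim: v => //= x v IH; rewrite filter_cat IH filter_map.
case: ifPn => ax /=; first by rewrite (@eq_filter _ _ a) => // y /=; rewrite ax.
rewrite (@eq_filter _ _ pred0) ?filter_pred0// => y /=.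
by rewrite (negbTE ax).
Qed.

Lemma mem_pairs {K : eqType} (v : seq K) k :
  k \in pairs v -> (k.1 \in v) && (k.2 \in v).
Proof.
elim: v => //= x v IH; rewrite mem_cat => /orP[/mapP[y yv ->]/=|/IH/andP[k1 k2]].
  by rewrite !inE eqxx yv orbT.
by rewrite !inE k1 k2 !orbT.
Qed.

Lemma uniq_pairs {K : eqType} (v : seq K) : uniq v -> uniq (pairs v).
Proof.
elim: v => //= x v IH /andP[xv uv]; rewrite cat_uniq IH// andbT.
rewrite map_inj_uniq ?uv/=; last by move=> y z [].
by apply/hasPn => k /mem_pairs/andP[k1 _]; apply: contra xv => /mapP[y _ ky];
  rewrite ky in k1.
Qed.

Lemma mem_pairs_sorted (v : seq nat) i j : sorted ltn v ->
  ((i, j) \in pairs v) = [&& i \in v, j \in v & (i < j)%N].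
Proof.
elim: v => //= x v IH xv; have sv := path_sorted xv.
have /allP xlt : all (ltn x) v := order_path_min ltn_trans xv.
rewrite mem_cat IH// !inE.
have -> : ((i, j) \in [seq (x, y) | y <- v]) = (i == x) && (j \in v).
  apply/mapP/andP => [[y yv [-> ->]]|[/eqP -> jv]]; first by rewrite eqxx.
  by exists j.
have [->|ix] := eqVneq i x; have [->|jx] /= := eqVneq j x;
  rewrite ?andbT ?andbF ?orbF//.
- by rewrite ltnn !andbF orbF; apply/negbTE/negP => /xlt/=; rewrite ltnn.
- apply/orP/andP => [[jv|/and3P[_ -> //]]|[jv _]]; last by left.
  by split => //; exact: xlt.
- apply/and3P/andP => [[-> _ ->]//|[iv ijx]].
  by have := xlt _ iv => /=; lia.
Qed.

(** * The Stein equation *)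

Section stein.
Context {R : realFieldType}.
Variables (q : nat -> R) (al c : R) (A : pred nat).
Let F k : R := \sum_(j < k) q j.
Let a k : R := \sum_(j < k | A j) q j.
Hypothesis al_gt0 : 0 < al.
Hypothesis q_gt0 : forall k, 0 < q k.
Hypothesis q_rec : forall k, k.+1%:R * q k.+1 = al * q k.
Hypothesis F_le1 : forall k, F k <= 1.
(** Total mass 1 stated without limits: no number below 1 bounds all partial sums. In [ca_ge0], [c]
    stands for the mass of [A] and [c - a k] for its part from [k] on. *)
Hypothesis F_sup : forall x, (forall k, F k <= x) -> 1 <= x.
Hypothesis ca_ge0 : forall k, 0 <= c - a k <= 1 - F k.

(* The value at [0] is irrelevant: the Stein equation multiplies it by [0]. *)
Definition stein_sol (k : nat) : R :=
  if k is k'.+1 then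
    (\sum_(j < k'.+1 | A j) q j - c * \sum_(j < k'.+1) q j) / (al * q k')
  else 0.

Let FS k : F k.+1 = F k + q k. Proof. by rewrite /F big_ord_recr. Qed.

Let aS k : a k.+1 = a k + (A k)%:R * q k.
Proof.
rewrite /a big_mkcond big_ord_recr/= -big_mkcond/=; congr +%R.
by case: (A k); rewrite ?mul1r ?mul0r.
Qed.

Let F_ge0 k : 0 <= F k. Proof. by apply: sumr_ge0 => i _; exact: ltW. Qed.

Let F_leD k M : F M <= F (k + M).
Proof. by elim: k => // k /le_trans; apply; rewrite addSn FS lerDl ltW. Qed.

Let a_ge0 k : 0 <= a k. Proof. by apply: sumr_ge0 => i _; exact: ltW. Qed.

Let a_leF k : a k <= F k.
Proof.
elim: k => [|k IH]; first by rewrite /a /F !big_ord0.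
by rewrite aS FS lerD// ler_piMl ?lern1 ?leq_b1// ltW.
Qed.

(** By [q_rec], [k * stein_sol k] has the same denominator [q k] as [al * stein_sol k.+1]; the
    numerators differ by [((A k)%:R - c) * q k]. *)
Lemma stein_solE k :
  al * stein_sol k.+1 - k%:R * stein_sol k = (A k)%:R - c.
Proof.
have qE j : q j != 0 by rewrite gt_eqF.
have alE : al != 0 by rewrite gt_eqF.
rewrite /stein_sol -/(F _) -/(a _) aS FS; case: k => [|k].
  by rewrite /a /F !big_ord0; field; rewrite qE alE.
rewrite -/(F _) -/(a _).
have kE : k.+1%:R != 0 :> R by rewrite pnatr_eq0.
have qkE : q k.+1 = al * q k / k.+1%:R.
  by apply: (mulfI kE); rewrite q_rec [RHS]mulrC divfK.
have -> : k.+1%:R * ((a k.+1 - c * F k.+1) / (al * q k)) =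
    (a k.+1 - c * F k.+1) / q k.+1.
  rewrite qkE; move: kE; move: (k.+1%:R : R) => m m0.
  by field; rewrite qE alE m0.
by field; rewrite qE alE.
Qed.

(** The ratio [q n.+1 / q n = al / n.+1] decreases in [n]. *)
Let q_logconcave i j : (i <= j)%N -> q i * q j.+1 <= q i.+1 * q j.
Proof.
move=> ij; have iE n : q n.+1 = al * q n / n.+1%:R.
  have kE : n.+1%:R != 0 :> R by rewrite pnatr_eq0.
  by apply: (mulfI kE); rewrite q_rec [RHS]mulrC divfK.
rewrite !iE.
have -> : q i * (al * q j / j.+1%:R) = al * q i * q j * j.+1%:R^-1 by ring.
have -> : al * q i / i.+1%:R * q j = al * q i * q j * i.+1%:R^-1 by ring.
rewrite ler_wpM2l ?mulr_ge0 ?(ltW al_gt0) ?(ltW (q_gt0 _))//.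
by rewrite lef_pV2 ?posrE ?ltr0n// ler_nat ltnS.
Qed.

(** Log-concavity summed over the indices below [n], each shifted up by one. The shift misses [q 0],
    which is the origin of the factor [1 - q 0] in the Stein bound. *)
Let head_le n k : (n <= k.+1)%N -> F n * q k.+1 <= (F n.+1 - q 0%N) * q k.
Proof.
elim: n => [|n IH] nk; first by rewrite FS /F !big_ord0 mul0r add0r subrr mul0r.
have := IH (ltnW nk); have := @q_logconcave n k nk.
by rewrite (FS n.+1) (FS n); lra.
Qed.

Let tail_le k : (1 - F k.+2) * q k <= (1 - F k.+1) * q k.+1.
Proof.
have tailM M :
    (F (k.+2 + M) - F k.+2) * q k <= (F (k.+1 + M) - F k.+1) * q k.+1.
  elim: M => [|M IH]; first by rewrite !addn0 !subrr !mul0r.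
  have qM : q k * q (k.+2 + M) <= q k.+1 * q (k.+1 + M).
    by apply: (@q_logconcave k (k.+1 + M)); rewrite addSn ltnW// ltnS leq_addr.
  have -> : F (k.+2 + M.+1) = F (k.+2 + M) + q (k.+2 + M) by rewrite addnS FS.
  have -> : F (k.+1 + M.+1) = F (k.+1 + M) + q (k.+1 + M) by rewrite addnS FS.
  lra.
(* The inequality for finite stretches of the tail, solved for the partial sum, holds for all [M];
   [F_sup] passes to the whole tail. *)
suff : 1 <= F k.+2 + (1 - F k.+1) * q k.+1 / q k.
  by rewrite -lerBlDl ler_pdivlMr.
apply: F_sup => M; rewrite -lerBlDl ler_pdivlMr//.
apply: (@le_trans _ _ ((F (k.+1 + M) - F k.+1) * q k.+1)); last first.
  by rewrite ler_wpM2r ?lerB// ltW.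
by apply: le_trans (tailM M); rewrite ler_wpM2r ?(ltW (q_gt0 _))// lerB.
Qed.

(* Writing [P] for the distribution with weights [q], the numerator of
   [stein_sol k.+1] is
   [P(A, <= k) P(> k) - P(A, > k) P(<= k)]; log-concavity of [q] makes
   [P(> k) / q k] nonincreasing and [P(<= k) / q k] nondecreasing. *)
Lemma stein_sol_diff_le k :
  stein_sol k.+1 - stein_sol k.+2 <= (1 - q 0%N) / al.
Proof.
have p0 := q_gt0 k; have r0 := q_gt0 k.+1.
rewrite /stein_sol -/(F _) -/(a _) -/(F _) -/(a _).
have H1 := tail_le k; have H2 := @head_le k.+1 k (leqnn _).
have /andP[b0 bF] := ca_ge0 k.+2; have aF := a_leF k.+1; have a0 := a_ge0 k.+1.
have F0 := F_ge0 k.+1; have F1 := F_le1 k.+2; have q00 := q_gt0 0%N.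
rewrite -(ler_pM2r (mulr_gt0 al_gt0 (mulr_gt0 p0 r0))).
have -> : ((a k.+1 - c * F k.+1) / (al * q k) -
    (a k.+2 - c * F k.+2) / (al * q k.+1)) * (al * (q k * q k.+1)) =
    (a k.+1 - c * F k.+1) * q k.+1 - (a k.+2 - c * F k.+2) * q k.
  by field; rewrite !gt_eqF.
have -> : (1 - q 0%N) / al * (al * (q k * q k.+1)) =
    (1 - q 0%N) * (q k * q k.+1) by field; rewrite gt_eqF.
set e : R := (A k.+1)%:R; have e0 : 0 <= e by rewrite /e ler0n.
(* The masses of [A] below and above [k.+1] get nonnegative coefficients, and membership of [k.+1]
   itself a nonpositive one: the extreme [A] is everything except [k.+1]. *)
have -> : (a k.+1 - c * F k.+1) * q k.+1 - (a k.+2 - c * F k.+2) * q k =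
   a k.+1 * ((1 - F k.+1) * q k.+1 - (1 - F k.+2) * q k)
   + (c - a k.+2) * (F k.+2 * q k - F k.+1 * q k.+1)
   - e * q k.+1 * (F k.+1 * q k.+1 + (1 - F k.+2) * q k).
  by rewrite (aS k.+1) -/e (FS k.+1); ring.
have L3 : 0 <= e * q k.+1 * (F k.+1 * q k.+1 + (1 - F k.+2) * q k).
  by rewrite !mulr_ge0 ?addr_ge0 ?mulr_ge0 ?subr_ge0// ltW.
have H3 : 0 <= F k.+2 * q k - F k.+1 * q k.+1.
  by have := mulr_gt0 q00 p0; move: H2; lra.
have H4 : 0 <= (1 - F k.+1) * q k.+1 - (1 - F k.+2) * q k by rewrite subr_ge0.
have L1 := ler_wpM2r H4 aF; have L2 := ler_wpM2r H3 bF.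
(* At that extreme the total is [q k.+1 * (F k.+1 * q k.+1 + (1 - F k.+2) * q k)]; [head_le] bounds
   the first summand, and [F k.+2] cancels. *)
have L4 := ler_wpM2r (ltW r0) H2.
move: L1 L2 L3 L4; rewrite (FS k.+1); nra.
Qed.

(** The numerator is at most the tail [1 - F k.+1], and by [tail_le] the ratio of tail to weight is
    largest at 0. Uniformity in [k] is what counts: the bound will be multiplied by a vanishing
    Poisson tail. *)
Lemma stein_sol_le k : stein_sol k <= (1 - q 0%N) / (al * q 0%N).
Proof.
have C0 : 0 <= (1 - q 0%N) / (al * q 0%N).
  rewrite divr_ge0 ?mulr_ge0 ?(ltW al_gt0) ?(ltW (q_gt0 _))// subr_ge0.
  by have := F_le1 1; rewrite /F big_ord1.
case: k => [//|k].
have tailC : (1 - F k.+1) / (al * q k) <= (1 - q 0%N) / (al * q 0%N).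
  elim: k => [|k IH]; first by rewrite /F big_ord1.
  apply: le_trans IH; rewrite ler_pdivrMr ?mulr_gt0//.
  have -> : (1 - F k.+1) / (al * q k) * (al * q k.+1) =
      (1 - F k.+1) * q k.+1 / q k by field; rewrite !gt_eqF.
  by rewrite ler_pdivlMr// tail_le.
apply: le_trans tailC; rewrite /stein_sol -/(F _) -/(a _).
apply: ler_wpM2r; first by rewrite invr_ge0 mulr_ge0 ?ltW.
have /andP[b0 _] := ca_ge0 k.+1.
have := ler_wpM2r (F_ge0 k.+1) b0.
have F1 : 0 <= 1 - F k.+1 by rewrite subr_ge0.
have := ler_wpM2r F1 (a_leF k.+1); have := mulr_ge0 F1 F1; lra.
Qed.

End stein.

(** * Bounded measurable functions and independence *)

Section bounded_measurable.
Context {d} {X : measurableType d} {R : realType}.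

(** A class closed under the operations used below and integrable against every probability, so that
    measurability and integrability are settled together. *)
Definition bmfun (g : X -> R) : Prop :=
  measurable_fun [set: X] g /\ exists C, forall x, `|g x| <= C.

Lemma bmfun_cst c : bmfun (cst c).
Proof. by split; [exact: measurable_cst | exists `|c|]. Qed.

Lemma bmfunD f g : bmfun f -> bmfun g -> bmfun (fun x => f x + g x).
Proof.
move=> [mf [C fC]] [mg [D gD]]; split; first exact: measurable_funD.
by exists (C + D) => x; apply: le_trans (ler_normD _ _) _; exact: lerD.
Qed.

Lemma bmfunM f g : bmfun f -> bmfun g -> bmfun (fun x => f x * g x).
Proof.
move=> [mf [C fC]] [mg [D gD]]; split; first exact: measurable_funM.
by exists (C * D) => x; rewrite normrM ler_pM.
Qed.

Lemma bmfunB f g : bmfun f -> bmfun g -> bmfun (fun x => f x - g x).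
Proof.
move=> [mf [C fC]] [mg [D gD]]; split; first exact: measurable_funB.
by exists (C + D) => x; apply: le_trans (ler_normB _ _) _; exact: lerD.
Qed.

Lemma bmfun_sum {K : Type} (r : seq K) (a : pred K) (f : K -> X -> R) :
  (forall k, bmfun (f k)) -> bmfun (fun x => \sum_(k <- r | a k) f k x).
Proof.
move=> bf; elim: r => [|k r IH].
  by under eq_fun do rewrite big_nil; exact: bmfun_cst.
under eq_fun do rewrite big_cons.
by case: (a k) => //; exact: bmfunD.
Qed.

Lemma bmfun_bern {K : Type} (p : K -> X -> R) (r : seq K) h :
  (forall k, bmfun (p k)) -> bmfun (fun x => bern (p ^~ x) r h).
Proof.
move=> bp; elim: r h => [|k r IH] h /=; first exact: bmfun_cst.
apply: bmfunD; apply: bmfunM => //.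
by apply: bmfunB => //; exact: bmfun_cst.
Qed.

Lemma bmfun_integrable_lty (m : {measure set X -> \bar R}) g :
  (m setT < +oo)%E -> bmfun g -> m.-integrable setT (EFin \o g).
Proof.
move=> mT [mg [C gC]]; apply: measurable_bounded_integrable => //.
by exists C; split; [exact: num_real | move=> M /ltW CM x _; exact: le_trans CM].
Qed.

Lemma bmfun_integrable (P : probability X R) g :
  bmfun g -> P.-integrable setT (EFin \o g).
Proof.
by apply: bmfun_integrable_lty; rewrite (le_lt_trans (probability_le1 _ _)) ?ltry.
Qed.

End bounded_measurable.

Lemma bmfun_comp {d d'} {X : measurableType d} {Y : measurableType d'}
    {R : realType} (g : Y -> R) (f : X -> Y) :
  measurable_fun [set: X] f -> bmfun g -> bmfun (g \o f).
Proof.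
move=> mf [mg [C gC]]; split; first exact: measurableT_comp.
by exists C => x; exact: gC.
Qed.

Section Rintegral_probability.
Context {d} {X : measurableType d} {R : realType} (P : probability X R).
Implicit Types f g : X -> R.

Lemma bm_RintegralD f g : bmfun f -> bmfun g ->
  \int[P]_x (f x + g x) = \int[P]_x f x + \int[P]_x g x.
Proof. by move=> bf bg; apply: RintegralD => //; exact: bmfun_integrable. Qed.

Lemma bm_RintegralB f g : bmfun f -> bmfun g ->
  \int[P]_x (f x - g x) = \int[P]_x f x - \int[P]_x g x.
Proof. by move=> bf bg; apply: RintegralB => //; exact: bmfun_integrable. Qed.

Lemma bm_RintegralZl c g : bmfun g ->
  \int[P]_x (c * g x) = c * \int[P]_x g x.
Proof. by move=> bg; apply: RintegralZl => //; exact: bmfun_integrable. Qed.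

Lemma bm_Rintegral_cst c : \int[P]_x c = c.
Proof.
rewrite Rintegral_cst// -[RHS]mulr1; congr (_ * _).
exact: (congr1 fine (probability_setT P)).
Qed.

Lemma bm_le_Rintegral f g : bmfun f -> bmfun g -> (forall x, f x <= g x) ->
  \int[P]_x f x <= \int[P]_x g x.
Proof.
by move=> bf bg fg; apply: le_Rintegral => //; exact: bmfun_integrable.
Qed.

Lemma bm_Rintegral_sum {K : Type} (r : seq K) (a : pred K) (f : K -> X -> R) :
  (forall k, bmfun (f k)) ->
  \int[P]_x (\sum_(k <- r | a k) f k x) = \sum_(k <- r | a k) \int[P]_x f k x.
Proof.
move=> bf; elim: r => [|k r IH].
  by under eq_Rintegral do rewrite big_nil; rewrite bm_Rintegral_cst big_nil.
under eq_Rintegral do rewrite big_cons.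
rewrite big_cons; case: (a k) => //.
by rewrite bm_RintegralD ?IH//; exact: bmfun_sum.
Qed.

End Rintegral_probability.

Lemma Rintegral_distribution {d0 d1} {Om : measurableType d0}
    {S1 : measurableType d1} {R : realType} (P : probability Om R)
    (Y : {RV P >-> S1}) (g : S1 -> R) : bmfun g ->
  \int[distribution P Y]_y g y = \int[P]_w g (Y w).
Proof.
move=> bg; congr fine.
rewrite (@integral_distribution _ _ _ _ _ P Y (EFin \o g))//.
- by apply/measurable_EFinP; exact: bg.1.
- by apply: (@bmfun_integrable _ _ _ _ (g \o Y)); exact: bmfun_comp.
Qed.

Section decoupling.
Context {d0 d1 d2} {Om : measurableType d0} {S1 : measurableType d1}
  {S2 : measurableType d2} {R : realType} (P : probability Om R).

(** Factorization on rectangles identifies the law of [(Y, Z)] with the product of the two laws;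
    Fubini then integrates over [Z] first. *)
Lemma indep_Rintegral (Y : {RV P >-> S1}) (Z : {RV P >-> S2}) (g : S1 * S2 -> R) :
  (forall C B, measurable C -> measurable B ->
    P (Y @^-1` C `&` Z @^-1` B) = (P (Y @^-1` C) * P (Z @^-1` B))%E) ->
  bmfun g ->
  \int[P]_w g (Y w, Z w) = \int[P]_u \int[P]_w g (Y u, Z w).
Proof.
move=> YZ bg.
have mYZ : measurable_fun setT (fun w => (Y w, Z w)).
  by apply/measurable_fun_pairP; split; exact: measurable_funPT.
pose YZm : {mfun Om >-> (S1 * S2)%type} :=
  HB.pack (fun w => (Y w, Z w)) (isMeasurableFun.Build _ _ _ _ _ mYZ).
have bgx x : bmfun (fun y => g (x, y)) by apply: (bmfun_comp _ bg).
have -> : \int[P]_w g (Y w, Z w) = \int[distribution P YZm]_z g z.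
  by rewrite Rintegral_distribution.
have -> : \int[distribution P YZm]_z g z =
    \int[(distribution P Y \x distribution P Z)%E]_z g z.
  congr fine; apply: eq_measure_integral => A mA _; apply/esym.
  exact: product_measure_unique.
have ig : (distribution P Y \x distribution P Z)%E.-integrable setT (EFin \o g).
  apply: bmfun_integrable_lty => //.
  rewrite [ltLHS](_ : _ = distribution P YZm setT); last first.
    exact: product_measure_unique.
  by rewrite (le_lt_trans (probability_le1 _ _)) ?ltry.
pose h x := \int[P]_w g (x, Z w).
have hE x : fubini_F (distribution P Z) (EFin \o g) x = (h x)%:E.
  rewrite /h -(@Rintegral_distribution _ _ _ _ _ P Z (fun y => g (x, y)))//.
  rewrite /Rintegral fineK//.
  apply: (integrable_fin_num measurableT).
  exact: (bmfun_integrable (distribution P Z) (bgx x)).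
have bh : bmfun h.
  split.
    apply/measurable_EFinP.
    rewrite (_ : EFin \o h = fubini_F (distribution P Z) (EFin \o g)).
      exact: (measurable_fubini_F ig).
    by apply/funext => x; rewrite hE.
  have [C gC] := bg.2; exists C => x; rewrite ler_norml.
  have bgZ : bmfun (fun w => g (x, Z w)).
    by apply: (bmfun_comp _ (bgx x)); exact: measurable_funPT.
  have gCx w : - C <= g (x, Z w) <= C by rewrite -ler_norml.
  apply/andP; split.
    rewrite -(bm_Rintegral_cst P (- C)).
    apply: bm_le_Rintegral => // [|w]; first exact: bmfun_cst.
    by have /andP[] := gCx w.
  rewrite -[leRHS](bm_Rintegral_cst P C).
  apply: bm_le_Rintegral => // [|w]; first exact: bmfun_cst.
  by have /andP[] := gCx w.
rewrite -(Rintegral_distribution _ bh) /Rintegral -integral12_prod_meas1//.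
by congr fine; apply: eq_integral => x _; exact: hE.
Qed.

End decoupling.

(** * Boxes as a generating class for the tuples *)

Section tuple_boxes.
Context {d} {T : measurableType d}.

Definition box {n} (A : 'I_n -> set T) : set (n.-tuple T) :=
  [set t | forall i, A i (tnth t i)].

Lemma measurable_box n (A : 'I_n -> set T) :
  (forall i, measurable (A i)) -> measurable (box A).
Proof.
move=> mA.
have -> : box A = \bigcap_(i in [set: 'I_n]) ((@tnth n T)^~ i @^-1` A i).
  by apply/seteqP; split=> [t At i _|t At i]; [exact: At|exact: At].
apply: fin_bigcap_measurable => [|i _]; first exact: finite_finset.
by rewrite -[X in measurable X]setTI; exact: measurable_tnth.
Qed.

(** Boxes are stable under intersection and generate the sigma-algebra, a constraint on one
    coordinate being a box with [setT] elsewhere. *)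
Lemma box_measure_unique {R : realType} n
    (m1 m2 : {measure set (n.-tuple T) -> \bar R}) : (m1 setT < +oo)%E ->
  (forall A : 'I_n -> set T, (forall i, measurable (A i)) ->
    m1 (box A) = m2 (box A)) ->
  forall B, measurable B -> m1 B = m2 B.
Proof.
move=> m1T m12.
pose G := [set box A | A in [set A : 'I_n -> set T | forall i, measurable (A i)]].
have GT : G setT.
  by exists (fun=> setT) => //; apply/seteqP; split.
apply: (@measure_unique _ _ _ G (fun=> setT)) => //.
- apply/seteqP; split.
    apply: smallest_sub; first exact: smallest_sigma_algebra.
    move=> B; rewrite -bigcup_seq => -[/= i _ [A mA <-]]; rewrite setTI.
    apply: sub_sigma_algebra.
    exists (fun j => if j == i then A else setT).
      by move=> j /=; case: ifP.
    apply/seteqP; split=> [t /(_ i)|t At j] /=; first by rewrite eqxx.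
    by case: eqP => [->|].
  apply: smallest_sub; first exact: sigma_algebra_measurable.
  by move=> _ [A mA <-]; exact: measurable_box.
- move=> _ _ [A mA <-] [B mB <-]; exists (fun i => A i `&` B i).
    by move=> i /=; exact: measurableI.
  apply/seteqP; split=> t /=; first by move=> AB; split=> i; have [] := AB i.
  by move=> [tA tB] i; split; [exact: tA|exact: tB].
- by rewrite bigcup_const//; exists 0%N.
- by move=> _ [A mA <-]; exact: m12.
Qed.

End tuple_boxes.

(** * The points of the random graph *)

Section random_graph_points.
Context {R : realType} {d} {T : measurableType d}.
Context {mu : probability T R} {s : R} {phi : T * T -> R}.
Context {dOm} {Om : measurableType dOm} {P : probability Om R}.
Variable G : random_graph mu s phi P.
Let X := rg_point G.
Let N := rg_size G.

(** The list of labels is arbitrary, so that exchangeability and independence of disjoint groups of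
    vertices can be stated by varying [v]. *)
Definition points {n} (v : n.-tuple nat) (w : Om) : n.-tuple T :=
  [tuple X (tnth v i) w | i < n].

Lemma tnth_points n (v : n.-tuple nat) w i :
  tnth (points v w) i = X (tnth v i) w.
Proof. exact: tnth_mktuple. Qed.

Lemma measurable_points n (v : n.-tuple nat) :
  measurable_fun [set: Om] (points v).
Proof.
apply/measurable_fun_tnthP => i.
rewrite (_ : _ \o _ = X (tnth v i)); first exact: measurable_funPT.
by apply/funext => w /=; exact: tnth_points.
Qed.

HB.instance Definition _ n (v : n.-tuple nat) :=
  isMeasurableFun.Build _ _ _ _ (points v) (@measurable_points n v).

Lemma size_indep_cylinder (C : set nat) (l : seq nat) (A : nat -> set T) :
  uniq l -> (forall k, measurable (A k)) ->
  P (N @^-1` C `&` \big[setI/setT]_(k <- l) (X k @^-1` A k)) =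
  (P (N @^-1` C) * \prod_(k <- l) mu (A k))%E.
Proof.
move=> ul mA.
pose B (o : option nat) := if o is Some k then X k @^-1` A k else N @^-1` C.
have := @rg_indep _ _ _ _ _ _ _ _ _ G (None :: map Some l) B.
rewrite !big_cons !big_map/= => ->.
- by congr (_ * _)%E; apply: eq_bigr => k _; exact: rg_point_law.
- rewrite map_inj_uniq ?ul ?andbT; last by move=> ? ? [].
  by apply/mapP => -[].
- move=> [k|] _ /=.
    by exists (A k); rewrite ?setTI.
  by exists C; rewrite ?setTI.
Qed.

Lemma points_box n (v : n.-tuple nat) (A : nat -> set T) :
  points v @^-1` box (fun i => A (tnth v i)) =
  \big[setI/setT]_(k <- v) (X k @^-1` A k).
Proof.
rewrite -bigcap_seq; apply/seteqP; split=> [w Aw k /= /tnthP[i ->]|w Aw i].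
  by have := Aw i; rewrite tnth_points.
by rewrite tnth_points; apply: Aw; exact: mem_tnth.
Qed.

Lemma cylinder_prob (l : seq nat) (A : nat -> set T) :
  uniq l -> (forall k, measurable (A k)) ->
  P (\big[setI/setT]_(k <- l) (X k @^-1` A k)) = (\prod_(k <- l) mu (A k))%E.
Proof.
move=> ul mA; have := size_indep_cylinder setT ul mA.
rewrite preimage_setT setTI => ->.
by have -> : P [set: Om] = 1%E; [exact: probability_setT | rewrite mul1e].
Qed.

(** Boxes are indexed by positions in [v], the independence of the points by labels; distinct labels
    allow passing from one to the other. *)
Lemma box_extend n (v : n.-tuple nat) (A : 'I_n -> set T) : uniq v ->
  (forall i, measurable (A i)) ->
  exists2 B : nat -> set T, forall k, measurable (B k) &
    forall i, B (tnth v i) = A i.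
Proof.
move=> uv mA.
exists (fun k => if [pick i | tnth v i == k] is Some i then A i else setT).
  by move=> k; case: pickP.
move=> i; case: pickP => [j /eqP vij|/(_ i)]; last by rewrite eqxx.
by have /tuple_uniqP/(_ _ _ vij) -> := uv.
Qed.

Lemma points_box_prob n (v : n.-tuple nat) (A : 'I_n -> set T) : uniq v ->
  (forall i, measurable (A i)) ->
  P (points v @^-1` box A) = (\prod_(i < n) mu (A i))%E.
Proof.
move=> uv mA; have [B mB BA] := box_extend uv mA.
rewrite (_ : A = fun i => B (tnth v i)); last by apply/funext => i; rewrite BA.
by rewrite points_box cylinder_prob// big_tuple.
Qed.

(** For fixed [D] both sides are finite measures in [B]: a restriction of [P] pushed forward, and a
    multiple of the law of the points. *)
Lemma indep_box_points n (v : n.-tuple nat) (D : set Om) : measurable D ->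
  (forall A : 'I_n -> set T, (forall i, measurable (A i)) ->
    P (D `&` points v @^-1` box A) = (P D * P (points v @^-1` box A))%E) ->
  forall B, measurable B ->
    P (D `&` points v @^-1` B) = (P D * P (points v @^-1` B))%E.
Proof.
move=> mD DA B mB.
have PDr : (0 <= fine (P D))%R by rewrite fine_ge0.
pose m1 : {measure set (n.-tuple T) -> \bar R} :=
  pushforward (mrestr P mD) (points v).
pose m1' := m1 (measurable_points v).
pose m2 : {measure set (n.-tuple T) -> \bar R} :=
  mscale (NngNum PDr) (distribution P (points v)).
have PDE : (fine (P D))%:E = P D by rewrite fineK// fin_num_measure.
have m1E A : m1' A = P (D `&` points v @^-1` A) by rewrite setIC.
have m2E A : m2 A = (P D * P (points v @^-1` A))%E.
  exact: (congr1 (fun x => x * P (points v @^-1` A))%E PDE).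
rewrite -m1E -m2E; apply: box_measure_unique => //.
  rewrite m1E preimage_setT setIT.
  by rewrite (le_lt_trans (probability_le1 _ _)) ?ltry.
by move=> A mA; rewrite m1E m2E DA.
Qed.

Lemma measurable_points_preimage n (v : n.-tuple nat) B :
  measurable B -> measurable (points v @^-1` B).
Proof. exact: measurable_funPTI. Qed.

Lemma size_points_indep (C : set nat) n (v : n.-tuple nat) B :
  uniq v -> measurable B ->
  P (N @^-1` C `&` points v @^-1` B) = (P (N @^-1` C) * P (points v @^-1` B))%E.
Proof.
move=> uv; apply: indep_box_points.
  exact: measurable_funPTI.
move=> A mA; have [A' mA' AA'] := box_extend uv mA.
rewrite (_ : A = fun i => A' (tnth v i)); last by apply/funext => i; rewrite AA'.
by rewrite points_box size_indep_cylinder// cylinder_prob.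
Qed.

Lemma points_indep m n (u : m.-tuple nat) (v : n.-tuple nat) A B :
  uniq (u ++ v) -> measurable A -> measurable B ->
  P (points u @^-1` A `&` points v @^-1` B) =
  (P (points u @^-1` A) * P (points v @^-1` B))%E.
Proof.
move=> uuv mA; move: (uuv); rewrite cat_uniq => /and3P[uu /hasPn uvN uv].
(* Boxes are reached in two reductions: here for [B], with the event on [u] fixed, and after
   swapping the factors for [A], with a box on [v] fixed. *)
apply: indep_box_points; first exact: measurable_points_preimage.
move=> B' mB'; rewrite setIC muleC.
move: A mA; apply: indep_box_points.
  by apply: measurable_points_preimage; exact: measurable_box.
move=> A mA.
have [A1 mA1 A1E] := box_extend uu mA; have [B1 mB1 B1E] := box_extend uv mB'.
pose C k := if k \in val u then A1 k else B1 k.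
have mC k : measurable (C k) by rewrite /C; case: ifP.
have CA : A = fun i => C (tnth u i).
  by apply/funext => i; rewrite /C -A1E ifT//; exact: mem_tnth.
have CB : B' = fun i => C (tnth v i).
  by apply/funext => i; rewrite /C -B1E ifN//; apply: uvN; exact: mem_tnth.
rewrite CA CB !points_box setIC -big_cat/=.
by rewrite !cylinder_prob// big_cat/= muleC.
Qed.

Lemma points_decouple m n (u : m.-tuple nat) (v : n.-tuple nat)
    (g : m.-tuple T * n.-tuple T -> R) :
  uniq (u ++ v) -> bmfun g ->
  \int[P]_w g (points u w, points v w) =
  \int[P]_w' \int[P]_w g (points u w', points v w).
Proof.
move=> uv bg.
apply: (@indep_Rintegral _ _ _ _ _ _ _ P (points u) (points v)) => //.
by move=> C B mC mB; exact: points_indep.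
Qed.

(** At distinct labels the points are independent with law [mu], whatever the labels. *)
Lemma points_exchange n (u v : n.-tuple nat) (g : n.-tuple T -> R) :
  uniq u -> uniq v -> bmfun g ->
  \int[P]_w g (points u w) = \int[P]_w g (points v w).
Proof.
move=> uu uv bg.
rewrite -(Rintegral_distribution (points u) bg).
rewrite -(Rintegral_distribution (points v) bg).
congr fine; apply: eq_measure_integral => B mB _.
apply: box_measure_unique => //.
  by rewrite (le_lt_trans (probability_le1 _ _)) ?ltry.
move=> A mA.
exact: etrans (points_box_prob uu mA) (esym (points_box_prob uv mA)).
Qed.

Lemma size_points_Rintegral (n m : nat) (v : m.-tuple nat) (g : m.-tuple T -> R) :
  uniq v -> bmfun g ->
  \int[P]_(w in N @^-1` [set n]) g (points v w) =
  fine (P (N @^-1` [set n])) * \int[P]_w g (points v w).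
Proof.
move=> uv bg.
have bI : bmfun (\1_[set n] : nat -> R).
  split; first exact: measurable_indic.
  by exists 1 => k; rewrite indicE; case: (_ \in _); rewrite ?normr1 ?normr0.
(* The restriction to the event becomes an indicator of the size, hence part of a function of two
   independent variables. *)
pose g' (z : nat * m.-tuple T) := \1_[set n] z.1 * g z.2.
have bg' : bmfun g'.
  by apply: bmfunM; [exact: (bmfun_comp _ bI)|exact: (bmfun_comp _ bg)].
have E1 : \int[P]_(w in N @^-1` [set n]) g (points v w) =
    \int[P]_w g' (N w, points v w).
  rewrite Rintegral_mkcond; apply: eq_Rintegral => w _.
  have inE : (w \in N @^-1` [set n]) = (N w \in [set n]).
    by apply/idP/idP; rewrite !inE.
  rewrite /g' patchE indicE /= inE.
  by case: ifP; rewrite ?mul1r ?mul0r.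
rewrite E1 (@indep_Rintegral _ _ _ _ _ _ _ P N (points v))//; last first.
  by move=> C B mC mB; exact: size_points_indep.
rewrite /g' /=.
have bgv : bmfun (g \o points v).
  by apply: (bmfun_comp _ bg); exact: measurable_points.
under eq_Rintegral do rewrite bm_RintegralZl// mulrC.
rewrite bm_RintegralZl; last by apply: (bmfun_comp _ bI); exact: measurable_funPT.
rewrite mulrC; congr (_ * _); congr fine.
have mN : measurable (N @^-1` [set n]) by exact: measurable_funPTI.
by rewrite -[in RHS](setIT (N @^-1` _)) -integral_indic.
Qed.

End random_graph_points.

(** * The number of edges given the number of points *)

Section conditional_edges.
Context {R : realType} {d} {T : measurableType d}.
Context {mu : probability T R} {s : R} {phi : T * T -> R}.
Context {dOm} {Om : measurableType dOm} {P : probability Om R}.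
Variable G : random_graph mu s phi P.
Hypothesis phi_conn : connection_function phi.
Let X := rg_point G.
Let N := rg_size G.

Lemma bmfun_phi : bmfun phi.
Proof.
case: phi_conn => mphi _ phi01; split => //; exists 1 => -[x y].
by have /andP[p0 p1] := phi01 x y; rewrite ger0_norm.
Qed.

Definition edge_prob (w : Om) (k : nat * nat) : R := phi (X k.1 w, X k.2 w).

Lemma edge_prob01 w k : 0 <= edge_prob w k <= 1.
Proof. by case: phi_conn => _ _; exact. Qed.

Lemma edge_probC w i j : edge_prob w (i, j) = edge_prob w (j, i).
Proof. by case: phi_conn => _ phiC _; exact: phiC. Qed.

Lemma bmfun_edge_prob k : bmfun (edge_prob ^~ k).
Proof.
apply: (bmfun_comp _ bmfun_phi).
by apply/measurable_fun_pairP; split; exact: measurable_funPT.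
Qed.

(* Conditional mean, given the points, of [h] of the number of edges among the
   vertices [v]. *)
Definition cond_edges (v : seq nat) (h : nat -> R) (w : Om) : R :=
  bern (edge_prob w) (pairs v) h.

Lemma bmfun_cond_edges v h : bmfun (cond_edges v h).
Proof. by apply: bmfun_bern => k; exact: bmfun_edge_prob. Qed.

(** [cond_edges] as a function of the tuple of points alone, the form to which exchangeability and
    decoupling apply. *)
Let tuple_edges n (h : nat -> R) (t : n.-tuple T) : R :=
  bern (fun k : 'I_n * 'I_n => phi (tnth t k.1, tnth t k.2))
    (pairs (enum 'I_n)) h.

Let bmfun_tuple_edges n h : bmfun (@tuple_edges n h).
Proof.
apply: bmfun_bern => k; apply: (bmfun_comp _ bmfun_phi).
by apply/measurable_fun_pairP; split; exact: measurable_tnth.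
Qed.

Let cond_edgesE n (v : n.-tuple nat) h w :
  cond_edges v h w = tuple_edges h (points G v w).
Proof.
rewrite /cond_edges -(map_tnth_enum v) pairs_map bern_map.
by apply: eq_bern => k _; rewrite /= !tnth_points.
Qed.

Definition mean_edges (n : nat) (h : nat -> R) : R :=
  \int[P]_w cond_edges (iota 0 n) h w.

Lemma Rintegral_cond_edges v h : uniq v ->
  \int[P]_w cond_edges v h w = mean_edges (size v) h.
Proof.
move=> uv; rewrite /mean_edges.
under eq_Rintegral do rewrite (cond_edgesE (in_tuple v)).
have sz : size (iota 0 (size v)) == size v by rewrite size_iota.
under [RHS]eq_Rintegral do rewrite (cond_edgesE (Tuple sz)).
exact: (@points_exchange _ _ _ _ _ _ _ _ _ _ _ (in_tuple v) (Tuple sz))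
  (iota_uniq _ _) _.
Qed.

Lemma size_Rintegral_cond_edges n m h :
  \int[P]_(w in N @^-1` [set n]) cond_edges (iota 0 m) h w =
  fine (P (N @^-1` [set n])) * mean_edges m h.
Proof.
have sz : size (iota 0 m) == m by rewrite size_iota.
rewrite /mean_edges; under eq_Rintegral do rewrite (cond_edgesE (Tuple sz)).
under [in RHS]eq_Rintegral do rewrite (cond_edgesE (Tuple sz)).
by rewrite size_points_Rintegral//=; exact: iota_uniq.
Qed.

Definition mean_edge : R := \int[P]_w edge_prob w (0%N, 1%N).

(** The probability that vertex 0 is joined to both 1 and 2; through it the overlaps between edges
    enter the bound. *)
Definition mean_cherry : R :=
  \int[P]_w (edge_prob w (0%N, 1%N) * edge_prob w (0%N, 2%N)).

Lemma Rintegral_edge_prob i j : i != j ->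
  \int[P]_w edge_prob w (i, j) = mean_edge.
Proof.
move=> ij; pose g (t : 2.-tuple T) := phi (tnth t ord0, tnth t ord_max).
have bg : bmfun g.
  apply: (bmfun_comp _ bmfun_phi).
  by apply/measurable_fun_pairP; split; exact: measurable_tnth.
have := @points_exchange _ _ _ _ _ _ _ _ _ G _ [tuple i; j] [tuple 0; 1]%N g.
rewrite /= inE ij => /(_ isT isT bg) e.
by do [transitivity (\int[P]_w g (points G [tuple i; j] w)); last rewrite e];
  apply: eq_Rintegral => w _; rewrite /g !tnth_points.
Qed.

Lemma Rintegral_cherry i j l : uniq [:: i; j; l] ->
  \int[P]_w (edge_prob w (i, j) * edge_prob w (i, l)) = mean_cherry.
Proof.
move=> uijl; pose i1 : 'I_3 := @Ordinal 3 1 isT.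
pose g (t : 3.-tuple T) :=
  phi (tnth t ord0, tnth t i1) * phi (tnth t ord0, tnth t ord_max).
have bg : bmfun g.
  by apply: bmfunM; apply: (bmfun_comp _ bmfun_phi);
    apply/measurable_fun_pairP; split; exact: measurable_tnth.
have e := @points_exchange _ _ _ _ _ _ _ _ _ G _
  [tuple i; j; l] [tuple 0; 1; 2]%N g uijl isT bg.
by do [transitivity (\int[P]_w g (points G [tuple i; j; l] w)); last rewrite e];
  apply: eq_Rintegral => w _; rewrite /g !tnth_points.
Qed.

(** The edge and the graph on [v] depend on disjoint groups of points. *)
Lemma Rintegral_edge_cond_edges i j v h : uniq [:: i, j & v] ->
  \int[P]_w (edge_prob w (i, j) * cond_edges v h w) =
  mean_edge * mean_edges (size v) h.
Proof.
move=> uv; pose u := [tuple i; j].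
pose g (z : 2.-tuple T * (size v).-tuple T) :=
  phi (tnth z.1 ord0, tnth z.1 ord_max) * tuple_edges h z.2.
have bphi : bmfun (fun t : 2.-tuple T => phi (tnth t ord0, tnth t ord_max)).
  apply: (bmfun_comp _ bmfun_phi).
  by apply/measurable_fun_pairP; split; exact: measurable_tnth.
have bg : bmfun g.
  apply: bmfunM; first exact: (bmfun_comp _ bphi).
  exact: (@bmfun_comp _ _ _ _ _ (@tuple_edges (size v) h) snd).
transitivity (\int[P]_w g (points G u w, points G (in_tuple v) w)).
  apply: eq_Rintegral => w _.
  by rewrite (cond_edgesE (in_tuple v)) /g /= !tnth_points.
rewrite points_decouple//.
have bu : bmfun (fun w => phi (X i w, X j w)) by exact: (bmfun_edge_prob (i, j)).
have bv : bmfun (fun w => cond_edges v h w) by exact: bmfun_cond_edges.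
rewrite -(Rintegral_cond_edges h (_ : uniq v)); last by case/and3P: uv.
transitivity (\int[P]_w (edge_prob w (i, j) * \int[P]_w' cond_edges v h w')).
  apply: eq_Rintegral => w _; rewrite -bm_RintegralZl//.
  apply: eq_Rintegral => w' _.
  by rewrite (cond_edgesE (in_tuple v)) /g /= !tnth_points.
under eq_Rintegral do rewrite mulrC.
rewrite bm_RintegralZl; last exact: bmfun_edge_prob.
rewrite mulrC Rintegral_edge_prob//.
by case/and3P: uv; rewrite inE negb_or => /andP[].
Qed.

Let avoid (k l : nat * nat) : bool :=
  (l.1 \notin [:: k.1; k.2]) && (l.2 \notin [:: k.1; k.2]).

(** Distinct edges that are not disjoint share exactly one vertex. It has four possible positions;
    the symmetry of [phi] moves it to the front of both pairs. *)
Lemma Rintegral_adjacent_edges v k l : sorted ltn v ->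
  k \in pairs v -> l \in pairs v -> l != k -> ~~ avoid k l ->
  \int[P]_w (edge_prob w k * edge_prob w l) = mean_cherry.
Proof.
case: k l => [i j] [a b] sv.
rewrite !mem_pairs_sorted// => /and3P[_ _ ij] /and3P[_ _ ab].
rewrite /avoid xpair_eqE /= !inE => lk kl.
have [ai|ai] := eqVneq a i.
  by subst a; rewrite Rintegral_cherry//= !inE; lia.
have [aj|aj] := eqVneq a j.
  subst a; under eq_Rintegral do rewrite (edge_probC _ i).
  by rewrite Rintegral_cherry//= !inE; lia.
have [bi|bi] := eqVneq b i.
  subst b; under eq_Rintegral do rewrite (edge_probC _ a).
  by rewrite Rintegral_cherry//= !inE; lia.
have bj : b = j by move: kl; lia.
subst b; under eq_Rintegral do rewrite (edge_probC _ i) (edge_probC _ a).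
by rewrite Rintegral_cherry//= !inE; lia.
Qed.

(** Every edge has [2 * (n - 2)] adjacent ones whatever its position, so all ['C(n, 2)] terms of the
    size-bias sum obey the same bound. With fewer than two vertices the claim is that the right side
    is nonnegative. *)
Lemma mean_edges_size_bias_ge n (f : nat -> R) (c : R) :
  (forall m, f m.+1 <= f m.+2 + c) ->
  'C(n, 2)%:R *
    (mean_edge * mean_edges (n - 2) (fun m => f m.+1)
     - c * (2 * (n - 2))%:R * mean_cherry) <=
  mean_edges n (fun m => m%:R * f m).
Proof.
move=> fc; set v := iota 0 n; pose r := pairs v.
have uv : uniq v := iota_uniq 0 n.
have sv : sorted ltn v := iota_ltn_sorted 0 n.
pose others k := [seq l <- r | l != k].
pose far k := [seq x <- v | x \notin [:: k.1; k.2]].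
have farE k : k \in r -> [seq l <- others k | avoid k l] = pairs (far k).
  move=> kr; rewrite -filter_pairs -filter_predI; apply: eq_filter => l /=.
  rewrite /avoid; case: (eqVneq l k) => [->|_]; last by rewrite andbT.
  by rewrite andbF inE eqxx.
have kP k : k \in r -> [/\ k.1 \in v, k.2 \in v & (k.1 < k.2)%N].
  by case: k => a b; rewrite mem_pairs_sorted// => /and3P.
have size_far k : k \in r -> size (far k) = (n - 2)%N.
  move=> kr; have [k1 k2 k12] := kP k kr.
  have := count_predC (mem [:: k.1; k.2]) v.
  rewrite size_iota size_filter => <-.
  rewrite (_ : count (mem [:: k.1; k.2]) v = 2%N) ?addKn//.
  rewrite -size_filter -[2%N]/(size [:: k.1; k.2]); apply: perm_size.
  apply: uniq_perm; rewrite ?filter_uniq//=; first by rewrite inE ltn_eqF.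
  by move=> x; rewrite mem_filter !inE; case: eqVneq => [->|_]/=; rewrite ?k1//;
    case: eqVneq => [->|].
have size_near k : k \in r ->
    count (fun l => ~~ avoid k l) (others k) = (2 * (n - 2))%N.
  move=> kr; have := count_predC (avoid k) (others k).
  rewrite -size_filter farE// size_pairs size_far//.
  have := count_predC (pred1 k) r; rewrite -(size_filter (predC (pred1 k))).
  rewrite count_uniq_mem ?uniq_pairs// kr size_pairs size_iota => e1.
  have n2 : (2 <= n)%N.
    by have := size_filter (mem [:: k.1; k.2]) v; move: kr; rewrite /r /v;
      case: (n) => [|[|]].
  (* The pairs that avoid [k], those sharing one endpoint with [k], and [k] itself. *)
  have binE : 'C(n, 2) = ('C(n - 2, 2) + 2 * (n - 2) + 1)%N.
    case: (n) n2 => [|[|m]]// _; rewrite subn2/= (binS m.+1) (binS m) !bin1; lia.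
  move=> e2; apply/eqP; rewrite -(eqn_add2l 'C(n - 2, 2)) e2.
  by rewrite -(eqn_add2l 1) e1 binE; lia.
have edge_ge k : k \in r ->
    mean_edge * mean_edges (n - 2) (fun m => f m.+1)
      - c * (2 * (n - 2))%:R * mean_cherry <=
    \int[P]_w (edge_prob w k * bern (edge_prob w) (others k) (fun m => f m.+1)).
  move=> kr; have [k1 k2 k12] := kP k kr.
  pose near w :=
    \sum_(l <- others k | ~~ avoid k l) (edge_prob w k * edge_prob w l).
  have bedge := bmfun_edge_prob.
  have bnear : bmfun near by apply: bmfun_sum => l; exact: bmfunM.
  have bcnear : bmfun (fun w => c * near w).
    by apply: bmfunM => //; exact: bmfun_cst.
  have bfar :
      bmfun (fun w => edge_prob w k * cond_edges (far k) (fun m => f m.+1) w).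
    by apply: bmfunM => //; exact: bmfun_cond_edges.
  have -> : mean_edge * mean_edges (n - 2) (fun m => f m.+1)
      - c * (2 * (n - 2))%:R * mean_cherry =
      \int[P]_w (edge_prob w k * cond_edges (far k) (fun m => f m.+1) w
                 - c * near w).
    rewrite bm_RintegralB// bm_RintegralZl//.
    rewrite -(size_far k kr) -(@Rintegral_edge_cond_edges k.1 k.2); last first.
      rewrite /= !inE !mem_filter !inE !eqxx orbT /= orbF filter_uniq// andbT.
      by rewrite ltn_eqF.
    rewrite -surjective_pairing; congr (_ - _); rewrite -mulrA; congr (_ * _).
    rewrite bm_Rintegral_sum; last by move=> l; exact: bmfunM.
    rewrite big_seq_cond (eq_bigr (fun=> mean_cherry)).
      rewrite -big_seq_cond big_const_seq iter_addr_0 size_far// mulr_natl.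
      by rewrite size_near.
    move=> l /andP[]; rewrite mem_filter => /andP[lk lr] kl.
    exact: (@Rintegral_adjacent_edges v).
  apply: bm_le_Rintegral => //; first exact: bmfunB.
    by apply: bmfunM => //; exact: bmfun_bern.
  move=> w; rewrite /near -mulr_sumr mulrCA -mulrBr.
  have /andP[p0 _] := edge_prob01 w k; apply: ler_wpM2l => //.
  rewrite lerBlDr /cond_edges -farE//; apply: bern_filter_le.
    exact: edge_prob01.
  by move=> m; exact: fc.
rewrite /mean_edges -/v /cond_edges -/r.
have -> : \int[P]_w bern (edge_prob w) r (fun m => m%:R * f m) =
    \int[P]_w \sum_(k <- r)
      edge_prob w k * bern (edge_prob w) (others k) (fun m => f m.+1).
  by apply: eq_Rintegral => w _; apply: bern_size_bias; exact: uniq_pairs.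
rewrite bm_Rintegral_sum; last first.
  by move=> k; apply: bmfunM; [|apply: bmfun_bern]; exact: bmfun_edge_prob.
rewrite -[in 'C(n, 2)](size_iota 0 n) -/v -size_pairs -/r mulr_natl.
rewrite -iter_addr_0 -count_predT -big_const_seq big_seq [leRHS]big_seq.
exact: ler_sum.
Qed.

Lemma mean_edges_nat n : mean_edges n (fun m => m%:R) = 'C(n, 2)%:R * mean_edge.
Proof.
rewrite /mean_edges /cond_edges.
under eq_Rintegral.
  move=> w _; rewrite -(_ : (fun m => m%:R * 1) = (fun m => m%:R)); last first.
    by apply/funext => m; rewrite mulr1.
  rewrite (@bern_size_bias _ _ _ _ (fun=> 1)) ?uniq_pairs ?iota_uniq//.
  under eq_bigr do rewrite bern_cst mulr1.
  over.
rewrite bm_Rintegral_sum; last by move=> k; exact: bmfun_edge_prob.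
rewrite -[in 'C(n, 2)](size_iota 0 n) -size_pairs mulr_natl.
rewrite -iter_addr_0 -count_predT -big_const_seq; apply: eq_big_seq => -[i j].
rewrite mem_pairs_sorted ?iota_ltn_sorted// => /and3P[_ _ ij].
by rewrite Rintegral_edge_prob// ltn_eqF.
Qed.

Lemma mean_edgesD n h g :
  mean_edges n (fun m => h m + g m) = mean_edges n h + mean_edges n g.
Proof.
rewrite /mean_edges -bm_RintegralD; try exact: bmfun_cond_edges.
by apply: eq_Rintegral => w _; exact: bernD.
Qed.

Lemma mean_edgesZ n c h : mean_edges n (fun m => c * h m) = c * mean_edges n h.
Proof.
rewrite /mean_edges -bm_RintegralZl; last exact: bmfun_cond_edges.
by apply: eq_Rintegral => w _; exact: bernZ.
Qed.

Lemma mean_edges_cst n c : mean_edges n (fun=> c) = c.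
Proof.
rewrite /mean_edges -[RHS](bm_Rintegral_cst P); apply: eq_Rintegral => w _.
exact: bern_cst.
Qed.

Lemma le_mean_edges n h g : (forall m, h m <= g m) ->
  mean_edges n h <= mean_edges n g.
Proof.
move=> hg; apply: bm_le_Rintegral; try exact: bmfun_cond_edges.
by move=> w; apply: le_bern => // k; exact: edge_prob01.
Qed.

End conditional_edges.

(** * The law of [H2] on the event that there are [n] points *)

Lemma mem_pairs_enum n (i j : 'I_n) :
  ((i, j) \in pairs (enum 'I_n)) = (i < j)%N.
Proof.
have valI : injective (fun k : 'I_n * 'I_n => (val k.1, val k.2)).
  by move=> [a b] [a' b'] /= [/val_inj -> /val_inj ->].
have := mem_pairs_sorted i j (iota_ltn_sorted 0 n).
rewrite -val_enum_ord pairs_map (mem_map valI (pairs (enum 'I_n)) (i, j)).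
by move=> ->; rewrite !map_f ?mem_enum.
Qed.

Lemma num_edgesE n (e : rel 'I_n) :
  num_edges e = count (fun k => e k.1 k.2) (pairs (enum 'I_n)).
Proof.
have ur : uniq (pairs (enum 'I_n)) by rewrite uniq_pairs ?enum_uniq.
rewrite -size_filter -(card_uniqP (filter_uniq _ ur)).
by apply: eq_card => -[i j]; rewrite mem_filter mem_pairs_enum andbC.
Qed.

Section conditional_law.
Context {R : realType} {d} {T : measurableType d}.
Context {mu : probability T R} {s : R} {phi : T * T -> R}.
Context {dOm} {Om : measurableType dOm} {P : probability Om R}.
Variable G : random_graph mu s phi P.
Hypothesis phi_conn : connection_function phi.
Let X := rg_point G.
Let N := rg_size G.

Lemma measurable_size n : measurable (N @^-1` [set n]).
Proof. exact: measurable_funPTI. Qed.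

Section fixed_size.
Variable n : nat.
Let K := ('I_n * 'I_n)%type.
Let r := pairs (enum 'I_n).
Let adj (w : Om) (k : K) : bool := rg_adj G k.1 k.2 w.
Let prob (w : Om) (k : K) : R := edge_prob G w (val k.1, val k.2).
Let event (r1 : seq K) (e : K -> bool) : set Om :=
  N @^-1` [set n] `&` [set w | forall k, k \in r1 -> adj w k = e k].

Let measurable_adj k b : measurable [set w | adj w k = b].
Proof.
exact: (measurable_funPTI (rg_adj G k.1 k.2) (Y := [set b])).
Qed.

Let measurable_event r1 e : measurable (event r1 e).
Proof.
apply: measurableI; first exact: measurable_size.
elim: r1 => [|k r1 IH].
  by rewrite (_ : [set w | _] = setT)//; apply/seteqP; split.
rewrite (_ : [set w | _] =
  [set w | adj w k = e k] `&` [set w | forall k, k \in r1 -> adj w k = e k]).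
  exact: measurableI.
apply/seteqP; split=> [w adjw|w [wk wr] l].
  by split=> [|l lr]; apply: adjw; rewrite inE ?eqxx// lr orbT.
by rewrite inE => /orP[/eqP ->//|]; exact: wr.
Qed.

Let measurable_count (r2 : seq K) (h : nat -> R) :
  measurable_fun [set: Om] (fun w => h (count (adj w) r2)).
Proof.
elim: r2 h => [|k r2 IH] h; first exact: (measurable_cst (h 0%N)).
rewrite (_ : (fun w => _) = (fun w => if adj w k then h (count (adj w) r2).+1
   else h (count (adj w) r2))); last first.
  by apply/funext => w /=; case: (adj w k).
apply: measurable_fun_ifT.
- exact: (measurable_funPT (rg_adj G k.1 k.2)).
- exact: (IH (fun m => h m.+1)).
- exact: IH.
Qed.

Let prob01 w k : 0 <= prob w k <= 1. Proof. exact: edge_prob01. Qed.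

Let weight (r1 : seq K) (e : K -> bool) (w : Om) : R :=
  \prod_(k <- r1) bernoulli_pmf (prob w k) (e k).

Let weight_ge0 r1 e w : 0 <= weight r1 e w.
Proof. by apply: prodr_ge0 => k _; exact: bernoulli_pmf_ge0. Qed.

Let measurable_weight r1 e : measurable_fun [set: Om] (weight r1 e).
Proof.
apply: measurable_prod => k _.
apply: (@measurableT_comp _ _ _ _ _ _ (@bernoulli_pmf R ^~ (e k))).
  exact: measurable_bernoulli_pmf.
exact: (bmfun_edge_prob G phi_conn _).1.
Qed.

(** The law [rg_adj_law] with no constraint on the points, its product over [i < j] rewritten along
    the list [r]. *)
Let event_prob e :
  P (event r e) = (\int[P]_(w in N @^-1` [set n]) (weight r e w)%:E)%E.
Proof.
have mT : measurable [set: n.-tuple T] := measurableT.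
have := rg_adj_law G (fun i j => e (i, j)) mT.
rewrite /=.
have -> : [set w | N w = n /\ [set: n.-tuple T] [tuple X i w | i < n]] =
   N @^-1` [set n] by apply/seteqP; split=> [w []//|w].
have -> : [set w | forall i j : 'I_n, (i < j)%N -> rg_adj G i j w = e (i, j)] =
    [set w | forall k, k \in r -> adj w k = e k].
  apply/seteqP; split=> w /= H.
    by move=> [i j]; rewrite mem_pairs_enum; exact: H.
  by move=> i j ij; apply: (H (i, j)); rewrite mem_pairs_enum.
move=> ->; apply: eq_integral => w _; congr EFin.
rewrite pair_big_dep /= /weight (big_uniq _ (uniq_pairs (enum_uniq _)))/=.
by apply: eq_big => -[i j]; rewrite /= ?mem_pairs_enum.
Qed.

(* Induction on the pairs [r2] whose edge indicators are not yet fixed. *)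
Let integral_event r1 r2 e (h : nat -> R) :
  r1 ++ r2 = r -> (forall m, 0 <= h m) ->
  (\int[P]_(w in event r1 e) (h (count (adj w) r2))%:E =
   \int[P]_(w in N @^-1` [set n]) (weight r1 e w * bern (prob w) r2 h)%:E)%E.
Proof.
have mterm l l' f g : measurable_fun (N @^-1` [set n])
    (fun w => (weight l f w * bern (prob w) l' g)%:E).
  apply/measurable_EFinP; apply: measurable_funTS.
  apply: measurable_funM; first exact: measurable_weight.
  by apply: (bmfun_bern _ _ _).1 => k; exact: bmfun_edge_prob.
elim: r2 r1 e h => [|k r2 IH] r1 e h r12 h0.
  (* No free pair is left: the event fixes every edge and [event_prob] applies. *)
  rewrite cats0 in r12; transitivity ((h 0%N)%:E * P (event r e))%E.
    by rewrite -r12; exact: (integral_cst P (measurable_event _ _) (h 0%N)%:E).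
  rewrite r12 event_prob -ge0_integralZl//.
  - by apply: eq_integral => w _; rewrite EFinM muleC.
  - exact: measurable_size.
  - by apply/measurable_EFinP; apply: measurable_funTS; exact: measurable_weight.
  - by move=> w _; rewrite lee_fin.
  - by rewrite lee_fin.
(* [eb b] prescribes the value [b] at [k]; the two values split the event exactly as [bern] splits
   its mean. *)
pose eb b l := if l == k then b else e l.
have kr1 : k \notin r1.
  have : uniq r by rewrite uniq_pairs ?enum_uniq.
  by rewrite -r12 cat_uniq /= negb_or => /and3P[_ /andP[]].
have eventE : event r1 e =
    event (rcons r1 k) (eb true) `|` event (rcons r1 k) (eb false).
  have ebr1 b l : l \in r1 -> eb b l = e l.
    by move=> lr1; rewrite /eb; case: eqP => // lk; rewrite -lk lr1 in kr1.
  apply/seteqP; split=> [w [wn wr1]|w [] [wn wr1]].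
  - case adjk: (adj w k); [left|right]; split=> // l; rewrite mem_rcons inE;
      by move=> /orP[/eqP ->|lr1]; [rewrite /eb eqxx|rewrite ebr1// wr1].
  - by split=> // l lr1; rewrite wr1 ?ebr1// mem_rcons inE lr1 orbT.
  - by split=> // l lr1; rewrite wr1 ?ebr1// mem_rcons inE lr1 orbT.
have adjk b w : event (rcons r1 k) (eb b) w -> adj w k = b.
  by move=> [_ /(_ k)]; rewrite mem_rcons inE eqxx /eb eqxx; exact.
have r12' : rcons r1 k ++ r2 = r by rewrite cat_rcons.
rewrite eventE ge0_integral_setU//; last 3 first.
- by apply/measurable_EFinP; apply: measurable_funTS; exact: measurable_count.
- by move=> w _; rewrite lee_fin.
- apply/disj_setPS => w [/adjk ? /adjk]; congruence.
have intE b : (\int[P]_(w in event (rcons r1 k) (eb b))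
      (h (count (adj w) (k :: r2)))%:E =
    \int[P]_(w in event (rcons r1 k) (eb b)) (h (b + count (adj w) r2)%N)%:E)%E.
  by apply: eq_integral => w; rewrite inE => /adjk /= ->.
rewrite !intE.
rewrite (IH _ _ (fun m => h m.+1))// IH// -ge0_integralD//.
- apply: eq_integral => w _; rewrite -EFinD; congr EFin.
  have wE b : weight (rcons r1 k) (eb b) w =
      weight r1 e w * bernoulli_pmf (prob w k) b.
    rewrite /weight -cats1 big_cat big_seq1 /= /eb eqxx; congr (_ * _).
    apply: eq_big_seq => l lr1; case: eqP => // lk.
    by rewrite -lk lr1 in kr1.
  by rewrite !wE /=; ring.
- exact: measurable_size.
- by move=> w _; rewrite lee_fin mulr_ge0// bern_ge0.
- by move=> w _; rewrite lee_fin mulr_ge0// bern_ge0.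
Qed.

(** The case of [integral_event] where no edge is prescribed. Nonnegative [h] covers both uses:
    indicators for probabilities, the identity for the mean. *)
Lemma size_integral_H2 (h : nat -> R) : (forall m, 0 <= h m) ->
  (\int[P]_(w in N @^-1` [set n]) (h (H2 G w))%:E =
   (fine (P (N @^-1` [set n])) * mean_edges G n h)%:E)%E.
Proof.
move=> h0; rewrite -size_Rintegral_cond_edges//.
have eventT : event [::] xpredT = N @^-1` [set n].
  by apply/seteqP; split=> [w []|w].
have rE w : bern (prob w) r h = cond_edges G (iota 0 n) h w.
  by rewrite /cond_edges -val_enum_ord pairs_map bern_map.
transitivity (\int[P]_(w in event [::] xpredT) (h (count (adj w) r))%:E)%E.
  rewrite eventT; apply: eq_integral => w; rewrite inE /= => wn.
  by rewrite /H2 wn num_edgesE.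
rewrite (@integral_event [::] r)// /Rintegral fineK.
  by apply: eq_integral => w _; rewrite /weight big_nil mul1r rE.
apply: integrable_fin_num; first exact: measurable_size.
apply: (@integrableS _ _ _ _ setT) => //; first exact: measurable_size.
by apply: bmfun_integrable; exact: bmfun_cond_edges.
Qed.

End fixed_size.

Lemma size_H2_prob n (A : set nat) :
  P (N @^-1` [set n] `&` H2 G @^-1` A) =
  (fine (P (N @^-1` [set n])) * mean_edges G n \1_A)%:E.
Proof.
rewrite -size_integral_H2; last by move=> m; rewrite indicE.
have mA : measurable (H2 G @^-1` A) by exact: measurable_funPTI.
rewrite setIC -(integral_indic P _ mA); last exact: measurable_size.
by apply: eq_integral => w _; rewrite !indicE; congr ((nat_of_bool _)%:R%:E);
  apply/idP/idP; rewrite !inE.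
Qed.
End conditional_law.

(** * Poisson mixtures *)

(** Serves both the graph, with [N] the number of points, and the Poisson law, with [N] the
    identity. *)
Lemma probability_partition_tail {d} {Om : measurableType d} {R : realType}
    (Q : probability Om R) (N : Om -> nat) (M : nat) (E : set Om) :
  measurable_fun [set: Om] N -> measurable E ->
  fine (Q E) = \sum_(n < M) fine (Q (N @^-1` [set (n : nat)] `&` E))
               + fine (Q ([set w | (M <= N w)%N] `&` E)).
Proof.
move=> mN mE; have mNI B : measurable (N @^-1` B).
  by rewrite -[X in measurable X]setTI; exact: mN.
elim: M => [|M ->].
  rewrite big_ord0 add0r; congr (fine (Q _)).
  by apply/seteqP; split=> [w|w []].
rewrite big_ord_recr/= -addrA; congr (_ + _).
have mM : measurable (N @^-1` [set M] `&` E).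
  by apply: measurableI => //; exact: mNI.
have mS : measurable ([set w | (M < N w)%N] `&` E).
  by apply: measurableI => //; exact: (mNI [set m | (M < m)%N]).
rewrite -fineD ?fin_num_measure// -measureU//.
  congr (fine (Q _)); apply/seteqP; split=> w /=.
    by rewrite leq_eqVlt => -[/orP[/eqP <-|MN] Ew]; [left|right].
  by move=> [[-> Ew]|[/ltnW MN Ew]].
by apply/seteqP; split=> // w [[/= -> _] []]; rewrite /= ltnn.
Qed.

(** * Poisson weights *)

Section poisson_pmf_facts.
Context {R : realType}.
Variables (a : R) (a_gt0 : 0 < a).

Lemma poisson_pmf_gt0 k : 0 < poisson_pmf a k.
Proof.
by rewrite /poisson_pmf a_gt0 !mulr_gt0 ?expR_gt0 ?exprn_gt0.
Qed.

Lemma poisson_pmf_rec k :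
  k.+1%:R * poisson_pmf a k.+1 = a * poisson_pmf a k.
Proof.
rewrite /poisson_pmf a_gt0 factS natrM exprS.
have k1 : k.+1%:R != 0 :> R by rewrite pnatr_eq0.
have kf : k`!%:R != 0 :> R by rewrite pnatr_eq0 -lt0n fact_gt0.
by move: k1; move: (k.+1%:R : R) => m m0; field; rewrite m0 kf.
Qed.

(** Makes the Stein constant [(1 - exp (- a)) / a] at most 1. *)
Lemma poisson_pmf0_ge : 1 - a <= poisson_pmf a 0.
Proof.
by rewrite /poisson_pmf a_gt0 expr0 fact0 invr1 !mul1r expR_ge1Dx.
Qed.

Lemma poisson_prob_set1 k : poisson_prob a 0 [set k] = (poisson_pmf a k)%:E.
Proof.
by rewrite /poisson_prob a_gt0 esum_set1// lee_fin poisson_pmf_ge0.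
Qed.

Lemma cvg_sum_poisson_pmf :
  \sum_(j < n) poisson_pmf a j @[n --> \oo] --> (1 : R).
Proof.
have -> : 1 = expR a * expR (- a) by rewrite -expRD subrr expR0.
have sumE n : \sum_(j < n) poisson_pmf a j =
    series (exp_coeff a) n * expR (- a).
  rewrite /series/= big_mkord mulr_suml.
  by apply: eq_bigr => j _; rewrite /poisson_pmf a_gt0.
rewrite (eq_cvg _ _ sumE).
by apply: cvgM; [exact: is_cvg_series_exp_coeff|exact: cvg_cst].
Qed.

Lemma sum_poisson_pmf_le1 n : \sum_(j < n) poisson_pmf a j <= 1.
Proof.
apply: (cvgr_to_ge cvg_sum_poisson_pmf); exists n => // m /= nm.
rewrite -(subnKC nm); elim: (m - n)%N => [|i IH]; first by rewrite addn0.
by rewrite addnS big_ord_recr/= (le_trans IH)// lerDl poisson_pmf_ge0.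
Qed.

Lemma sum_poisson_pmf_sup x :
  (forall n, \sum_(j < n) poisson_pmf a j <= x) -> 1 <= x.
Proof.
move=> Fx; apply: (cvgr_to_le cvg_sum_poisson_pmf); apply: nearW => n; exact: Fx.
Qed.

(** The difference is the mass of [A] from [k] on; this is the hypothesis [ca_ge0] of the Stein
    bounds. *)
Lemma poisson_prob_tail (A : set nat) k :
  0 <= fine (poisson_prob a 0 A)
       - \sum_(j < k | (j : nat) \in A) poisson_pmf a j
    <= 1 - \sum_(j < k) poisson_pmf a j.
Proof.
have mid : measurable_fun [set: nat] (@id nat) by [].
pose Q : probability nat R := poisson_prob a 0.
have tailE B := @probability_partition_tail _ _ _ Q _ k B mid I.
have sumE B : \sum_(n < k) fine (Q (id @^-1` [set (n : nat)] `&` B)) =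
    \sum_(j < k | (j : nat) \in B) poisson_pmf a j.
  rewrite [RHS]big_mkcond; apply: eq_bigr => j _.
  rewrite preimage_id; case: ifPn => [|]; rewrite ?inE ?notin_setE => jB.
    by rewrite setIidl => [|_ ->//]; exact: (congr1 fine (poisson_prob_set1 j)).
  by rewrite (_ : _ `&` _ = set0) ?measure0//; apply/seteqP; split=> // _ [->].
have := tailE setT; rewrite (_ : fine (Q setT) = 1); last first.
  exact: (congr1 fine (probability_setT Q)).
rewrite -/(fine (Q A)) (tailE A) !sumE (eq_bigl xpredT); last first.
  by move=> j; rewrite in_setT.
rewrite setIT => ->.
have tA0 : 0 <= fine (Q ([set w | (k <= w)%N] `&` A)) by rewrite fine_ge0.
have tA1 : fine (Q ([set w | (k <= w)%N] `&` A)) <= fine (Q [set w | (k <= w)%N]).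
  by rewrite fine_le ?fin_num_measure// le_measure ?inE.
by apply/andP; split; lra.
Qed.

End poisson_pmf_facts.

(** * The graph on a Poisson number of points *)

Section poisson_mixture.
Context {R : realType} {d} {T : measurableType d}.
Context {mu : probability T R} {s : R} {phi : T * T -> R}.
Context {dOm} {Om : measurableType dOm} {P : probability Om R}.
Variable G : random_graph mu s phi P.
Hypothesis s_gt0 : 0 < s.
Hypothesis phi_conn : connection_function phi.
Let X := rg_point G.
Let N := rg_size G.

Let degree (x : T) : R := \int[mu]_y phi (x, y).

Let bmfun_phi_section x : bmfun (fun y => phi (x, y)).
Proof. exact: (bmfun_comp _ (bmfun_phi phi_conn)). Qed.

Let integral_phi_section x : (\int[mu]_y (phi (x, y))%:E)%E = (degree x)%:E.
Proof.
rewrite /degree /Rintegral fineK//; apply: integrable_fin_num => //.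
exact: (bmfun_integrable mu (bmfun_phi_section x)).
Qed.

Let bmfun_degree : bmfun degree.
Proof.
have [mphi _ phi01] := phi_conn; split.
  apply/measurable_EFinP.
  rewrite (_ : EFin \o degree = fubini_F mu (EFin \o phi)); last first.
    by apply/funext => x; rewrite /= -integral_phi_section.
  apply: measurable_fun_fubini_tonelli_F; first exact/measurable_EFinP.
  by move=> [x y]; rewrite /= lee_fin; have /andP[] := phi01 x y.
exists 1 => x; rewrite ger0_norm; last first.
  by apply: Rintegral_ge0 => y _; have /andP[] := phi01 x y.
rewrite -[leRHS](bm_Rintegral_cst mu); apply: bm_le_Rintegral => //.
  exact: bmfun_cst.
by move=> y; have /andP[] := phi01 x y.
Qed.

Let Rintegral_point k (g : T -> R) : bmfun g ->
  \int[P]_w g (X k w) = \int[mu]_x g x.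
Proof.
move=> bg; rewrite -(Rintegral_distribution (X k) bg); congr fine.
by apply: eq_measure_integral => A mA _; exact: rg_point_law.
Qed.

(** Given the point at 0, the two edges depend on independent points and each has mean [degree]:
    decoupling separates 0 from 1 and 2, then 1 from 2. *)
Lemma mean_cherryE : mean_cherry G = \int[mu]_x degree x ^+ 2.
Proof.
have bphi := bmfun_phi phi_conn.
have mtnth d' (S : measurableType d') n (i : 'I_n) (f : S -> n.-tuple T) :
    measurable_fun [set: S] f -> measurable_fun [set: S] (fun z => tnth (f z) i).
  by move=> mf; exact: (measurableT_comp (measurable_tnth i) mf).
pose g1 (z : 1.-tuple T * 2.-tuple T) :=
  phi (tnth z.1 ord0, tnth z.2 ord0) * phi (tnth z.1 ord0, tnth z.2 ord_max).
have bg1 : bmfun g1.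
  apply: bmfunM; apply: (bmfun_comp _ bphi); apply/measurable_fun_pairP; split;
    exact: mtnth.
transitivity (\int[P]_w g1 (points G [tuple 0]%N w, points G [tuple 1; 2]%N w)).
  by apply: eq_Rintegral => w _; rewrite /g1 /= !tnth_points.
rewrite points_decouple//.
have bdeg2 : bmfun (fun x => degree x ^+ 2).
  by under eq_fun do rewrite expr2; exact: bmfunM.
rewrite -(Rintegral_point 0 bdeg2); apply: eq_Rintegral => w' _.
set x := X 0 w'; have bx := bmfun_phi_section x.
pose g2 (z : 1.-tuple T * 1.-tuple T) :=
  phi (x, tnth z.1 ord0) * phi (x, tnth z.2 ord0).
have bg2 : bmfun g2.
  by apply: bmfunM; apply: (bmfun_comp _ bx); exact: mtnth.
have bX k : bmfun (fun w => phi (x, X k w)).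
  by apply: (bmfun_comp _ bx); exact: measurable_funPT.
have degX k : \int[P]_w phi (x, X k w) = degree x := Rintegral_point k bx.
transitivity (\int[P]_w g2 (points G [tuple 1]%N w, points G [tuple 2]%N w)).
  by apply: eq_Rintegral => w _; rewrite /g1 /g2 /= !tnth_points.
rewrite points_decouple// expr2.
transitivity (\int[P]_w (phi (x, X 1 w) * degree x)).
  apply: eq_Rintegral => w _; rewrite -(degX 2%N) -bm_RintegralZl//.
  by apply: eq_Rintegral => w2 _; rewrite /g2 /= !tnth_points.
under eq_Rintegral do rewrite mulrC.
by rewrite bm_RintegralZl// degX.
Qed.

Lemma integral_degree_sq :
  (\int[mu]_x ((\int[mu]_y (phi (x, y) * s)%:E) ^+ 2 * s%:E))%E =
  (s ^+ 3 * mean_cherry G)%:E.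
Proof.
have inner x : (\int[mu]_y (phi (x, y) * s)%:E)%E = (degree x * s)%:E.
  under eq_integral do rewrite EFinM.
  rewrite integralZr// ?integral_phi_section//.
  exact: (bmfun_integrable mu (bmfun_phi_section x)).
have bdeg2 : bmfun (fun x => degree x ^+ 2).
  by under eq_fun do rewrite expr2; exact: bmfunM.
rewrite mean_cherryE -bm_RintegralZl// /Rintegral fineK; last first.
  apply: integrable_fin_num => //; apply: (@bmfun_integrable _ _ _ mu).
  by apply: bmfunM => //; exact: bmfun_cst.
apply: eq_integral => x _; rewrite inner.
by rewrite -!EFin_expe -!EFinM; congr EFin; ring.
Qed.

Lemma size_prob n : fine (P (N @^-1` [set n])) = poisson_pmf s n.
Proof.
have := rg_size_law G [set n]; rewrite poisson_prob_set1//.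
by rewrite /distribution /pushforward /= => ->.
Qed.

Let q n : R := poisson_pmf s n.

(* The discrete form of the Mecke formula: removing the two endpoints of an edge
   replaces [n.+2] points by [n] at the cost of a factor [s ^+ 2 / 2]. *)
Lemma poisson_pmf_bin2 n : q n.+2 * 'C(n.+2, 2)%:R = s ^+ 2 / 2 * q n.
Proof.
have e1 := poisson_pmf_rec s_gt0 n; have e2 := poisson_pmf_rec s_gt0 n.+1.
have -> : 'C(n.+2, 2)%:R = n.+2%:R * n.+1%:R / 2 :> R.
  rewrite -natrM; apply: (canRL (mulfK _)); first by rewrite pnatr_eq0.
  by rewrite -natrM; congr (_%:R); have := bin_ffact n.+2 2;
    rewrite !ffactnS ffactn0 muln1.
rewrite -/(q _) in e1 e2 *; move: e1 e2; rewrite -/(q _) -/(q _).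
move: (n.+2%:R : R) (n.+1%:R : R) => a b e1 e2.
have -> : q n.+2 * (a * b / 2) = a * q n.+2 * b / 2 by ring.
by rewrite e2 expr2 -[s * q _ * b]mulrA (mulrC _ b) e1; ring.
Qed.

Lemma expectation_H2 :
  ('E_P[fun w => (H2 G w)%:R] = (s ^+ 2 / 2 * mean_edge G)%:E)%E.
Proof.
rewrite unlock.
have UN : \bigcup_n (N @^-1` [set n]) = [set: Om].
  by apply/seteqP; split=> // w _; exists (N w).
have mH2 : measurable_fun [set: Om] (fun w => ((H2 G w)%:R : R)%:E).
  apply/measurable_EFinP.
  have mR : measurable_fun [set: nat] (fun n : nat => n%:R : R) by [].
  exact: (measurableT_comp mR (measurable_H2 G)).
have tN : trivIset setT (fun n => N @^-1` [set n]).
  apply/trivIsetP => i j _ _ ij; apply/seteqP; split=> // w [/= -> /eqP].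
  by rewrite (negbTE ij).
rewrite -UN ge0_integral_bigcup ?UN//; last exact: measurable_size.
under eq_eseriesr.
  move=> n _; rewrite (size_integral_H2 G phi_conn n (h := fun m => m%:R))//.
  rewrite mean_edges_nat// size_prob.
  over.
pose u n : R := \sum_(i < n) q i * ('C(i, 2)%:R * mean_edge G).
have cu : u n @[n --> \oo] --> s ^+ 2 / 2 * mean_edge G.
  (* The terms for 0 and 1 points vanish; after the shift [poisson_pmf_bin2] leaves the total
     Poisson mass. *)
  rewrite -(cvg_shiftn 2).
  have uE n : u (n + 2)%N = s ^+ 2 / 2 * mean_edge G * \sum_(j < n) q j.
    rewrite addn2 /u 2!big_ord_recl/= !bin_small// !(mul0r, mulr0, add0r).
    rewrite mulr_sumr.
    apply: eq_bigr => j _; rewrite mulrA poisson_pmf_bin2; ring.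
  rewrite (eq_cvg _ _ uE).
  have := cvgM (cvg_cst (s ^+ 2 / 2 * mean_edge G)) (cvg_sum_poisson_pmf s_gt0).
  rewrite mulr1 => cvgM1; exact: cvgM1.
rewrite [LHS](_ : _ = limn (EFin \o u)).
  rewrite EFin_lim; first by congr EFin; exact: cvg_lim.
  by apply/cvg_ex; eexists; exact: cu.
by congr (limn _); apply/funext => n; rewrite big_mkord sumEFin.
Qed.

(** For sizes from [M] on, the whole Poisson mass is conceded. *)
Lemma H2_prob_le (A : set nat) M :
  fine (P (H2 G @^-1` A)) <=
  \sum_(n < M) q n * mean_edges G n \1_A + (1 - \sum_(n < M) q n).
Proof.
have mA : measurable (H2 G @^-1` A) by exact: measurable_funPTI.
have mM : measurable [set w | (M <= N w)%N].
  exact: (measurable_funPTI N (Y := [set m | (M <= m)%N])).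
have tailE B := @probability_partition_tail _ _ _ P N M B (measurable_funPT N).
rewrite (tailE _ mA).
have := tailE _ (@measurableT _ Om).
rewrite (_ : fine (P setT) = 1); last exact: (congr1 fine (probability_setT P)).
under eq_bigr do rewrite setIT size_prob.
rewrite setIT => eT; rewrite {}eT addrAC subrr add0r.
apply: lerD.
  by apply: ler_sum => n _; rewrite size_H2_prob//= size_prob.
rewrite fine_le// ?fin_num_measure//; first exact: measurableI.
by apply: le_measure; rewrite ?inE//; exact: measurableI.
Qed.

End poisson_mixture.

(** * The Stein bound *)

Section stein_poisson.
Context {R : realType} {d} {T : measurableType d}.
Context {mu : probability T R} {s : R} {phi : T * T -> R}.
Context {dOm} {Om : measurableType dOm} {P : probability Om R}.
Variable G : random_graph mu s phi P.
Hypothesis s_gt0 : 0 < s.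
Hypothesis phi_conn : connection_function phi.
Let q n : R := poisson_pmf s n.
Let al : R := s ^+ 2 / 2 * mean_edge G.

Lemma mean_edge_ge0 : 0 <= mean_edge G.
Proof.
apply: Rintegral_ge0 => w _.
by have /andP[] := edge_prob01 G phi_conn w (0, 1)%N.
Qed.

Lemma mean_cherry_ge0 : 0 <= mean_cherry G.
Proof.
have p0 w k : 0 <= edge_prob G w k by have /andP[] := edge_prob01 G phi_conn w k.
by apply: Rintegral_ge0 => w _; exact: mulr_ge0.
Qed.

(** The size-bias bound at [n.+2], weighted by [q n.+2], yields a main term with factor [al * q n]
    that cancels the positive term at [n]; only the two highest survive. Its error is [s ^+ 2 / 2 *
    q n * c * (2 * n) * mean_cherry G]. *)
Lemma sum_stein_le (f : nat -> R) (c : R) M :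
  (forall m, f m.+1 <= f m.+2 + c) ->
  \sum_(n < M.+2) q n * (al * mean_edges G n (fun m => f m.+1)
                         - mean_edges G n (fun m => m%:R * f m)) <=
  al * (q M * mean_edges G M (fun m => f m.+1)
        + q M.+1 * mean_edges G M.+1 (fun m => f m.+1))
  + s ^+ 2 * c * mean_cherry G * \sum_(n < M) n%:R * q n.
Proof.
move=> fc; set w := fun n => mean_edges G n (fun m => f m.+1).
set u := fun n => mean_edges G n (fun m => m%:R * f m).
have q0 n : 0 <= q n by exact: poisson_pmf_ge0.
have u_ge n := mean_edges_size_bias_ge G phi_conn n fc.
elim: M => [|M IH].
  (* Sizes 0 and 1 admit no edge; there the size-bias bound only gives nonnegativity of [u]. *)
  rewrite big_ord_recr big_ord1 big_ord0 /= -/(w 0%N) -/(w 1%N).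
  rewrite -/(u 0%N) -/(u 1%N).
  have u0 : 0 <= u 0%N by have := u_ge 0%N; rewrite bin_small// mul0r.
  have u1 : 0 <= u 1%N by have := u_ge 1%N; rewrite bin_small// mul0r.
  have := mulr_ge0 (q0 0%N) u0; have := mulr_ge0 (q0 1%N) u1; lra.
rewrite big_ord_recr [X in _ <= _ + _ * X]big_ord_recr/=.
have := ler_wpM2l (q0 M.+2) (u_ge M.+2).
rewrite mulrA poisson_pmf_bin2// subn2/= -/(w M) -/(u M.+2) -/(w M.+2).
rewrite natrM.
move: IH; rewrite -/(w M) -/(w M.+1) -/(w M.+2) /al -/(q M); lra.
Qed.

(** A truncated Poisson mean, by [poisson_pmf_rec]; it supplies the third factor [s]. *)
Lemma sum_nat_poisson_le M : \sum_(n < M) n%:R * q n <= s.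
Proof.
have q0 n : 0 <= q n by exact: poisson_pmf_ge0.
have e n : \sum_(j < n.+1) j%:R * q j = s * \sum_(j < n) q j.
  rewrite big_ord_recl/= mul0r add0r mulr_sumr; apply: eq_bigr => j _.
  exact: poisson_pmf_rec.
case: M => [|M]; first by rewrite big_ord0 ltW.
by rewrite e -[leRHS]mulr1 ler_wpM2l ?sum_poisson_pmf_le1// ltW.
Qed.

(** If [y < x] and [0 < c], all partial sums would be at most [1 - (x - y) / c], against total mass
    1. *)
Lemma poisson_tail_limit (x y c : R) : 0 <= c ->
  (forall M, x <= y + c * (1 - \sum_(n < M) q n)) -> x <= y.
Proof.
move=> c0 xy; rewrite leNgt; apply/negP => yx.
have [c_eq0|c_neq0] := eqVneq c 0.
  by have := xy 0%N; rewrite c_eq0 mul0r addr0 leNgt yx.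
have c_gt0 : 0 < c by rewrite lt_neqAle eq_sym c_neq0.
suff : 1 <= 1 - (x - y) / c.
  by rewrite leNgt gtrBl divr_gt0 ?subr_gt0.
apply: (sum_poisson_pmf_sup s_gt0) => M.
by rewrite lerBrDr addrC -lerBrDr ler_pdivrMr// mulrC lerBlDl.
Qed.

(** First moment bound: as 0 is not in [A], the indicator of [A] is at most the identity, whose mean
    vanishes. *)
Let H2_prob0 (A : set nat) : mean_edge G = 0 -> ~ A 0%N ->
  fine (P (H2 G @^-1` A)) <= 0.
Proof.
move=> me0 A0; apply: (@poisson_tail_limit _ _ 1) => // M.
rewrite add0r mul1r; apply: le_trans (H2_prob_le G s_gt0 phi_conn A M) _.
rewrite gerDr; apply: sumr_le0 => n _; apply: mulr_ge0_le0.
  exact: poisson_pmf_ge0.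
have <- : mean_edges G n (fun m => m%:R) = 0.
  by rewrite mean_edges_nat// me0 mulr0.
apply: le_mean_edges => // m; rewrite indicE.
by case: m => [|m]; [rewrite memNset|rewrite ler_nat (leq_trans (leq_b1 _))].
Qed.

Let H2_prob_stein (A : set nat) : 0 < al ->
  fine (P (H2 G @^-1` A)) - fine (poisson_prob al 0 A) <=
  min1V al * (s ^+ 3 * mean_cherry G).
Proof.
move=> al_gt0; set c := fine (poisson_prob al 0 A).
pose pi := poisson_pmf al; pose a : pred nat := fun k => k \in A.
have pi_gt0 := poisson_pmf_gt0 al_gt0.
have pi0_le1 : pi 0%N <= 1.
  by have := sum_poisson_pmf_le1 al_gt0 1; rewrite big_ord1.
have ca k : 0 <= c - \sum_(j < k | a j) pi j <= 1 - \sum_(j < k) pi j.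
  exact: poisson_prob_tail.
have sE := @stein_solE _ pi al c a al_gt0 pi_gt0 (poisson_pmf_rec al_gt0).
have sD := @stein_sol_diff_le _ pi al c a al_gt0 pi_gt0 (poisson_pmf_rec al_gt0)
  (sum_poisson_pmf_le1 al_gt0) (sum_poisson_pmf_sup al_gt0) ca.
have sC := @stein_sol_le _ pi al c a al_gt0 pi_gt0 (poisson_pmf_rec al_gt0)
  (sum_poisson_pmf_le1 al_gt0) (sum_poisson_pmf_sup al_gt0) ca.
set f := stein_sol pi al c a in sE sD sC *.
set C := (1 - pi 0%N) / (al * pi 0%N) in sC.
set K := (1 - pi 0%N) / al in sD.
(* Since [pi 0] is [exp (- al)], the numerator of [K] is at most [al] and at most 1. *)
have K_min : K <= min1V al.
  rewrite /min1V gt_eqF// le_min; apply/andP; split.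
    by rewrite ler_pdivrMr// mul1r lerBlDr addrC -lerBlDr poisson_pmf0_ge.
  by rewrite -[leRHS]mul1r ler_wpM2r ?invr_ge0 ?(ltW al_gt0)// gerBl ltW.
have C0 : 0 <= C by rewrite divr_ge0 ?subr_ge0// mulr_ge0 ?ltW.
have beta0 := mean_cherry_ge0.
have c0 : 0 <= c by rewrite fine_ge0.
have K0 : 0 <= K by rewrite divr_ge0 ?subr_ge0// ltW.
apply: (@le_trans _ _ (K * (s ^+ 3 * mean_cherry G))); last first.
  by rewrite ler_wpM2r// mulr_ge0// exprn_ge0// ltW.
(* [al * C] pays for the two terms left by the telescoping, 1 for the sizes conceded in
   [H2_prob_le]. *)
apply: (@poisson_tail_limit _ _ (al * C + 1)).
  by rewrite addr_ge0// mulr_ge0// ltW.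
move=> M.
have fK m : f m.+1 <= f m.+2 + K by rewrite addrC -lerBlDr.
have HP := H2_prob_le G s_gt0 phi_conn A M.+2.
have HS := sum_stein_le M fK.
have steinE n : al * mean_edges G n (fun m => f m.+1)
    - mean_edges G n (fun m => m%:R * f m) = mean_edges G n \1_A - c.
  apply/eqP; rewrite subr_eq -mean_edgesZ// -[c](mean_edges_cst G n) -mulN1r.
  rewrite -mean_edgesZ// -!mean_edgesD//; apply/eqP; congr mean_edges.
  by apply/funext => m; have := sE m; rewrite indicE /a; lra.
have {}HS : \sum_(n < M.+2) q n * mean_edges G n \1_A - c * \sum_(n < M.+2) q n <=
    al * (q M * mean_edges G M (fun m => f m.+1)
          + q M.+1 * mean_edges G M.+1 (fun m => f m.+1))
    + s ^+ 2 * K * mean_cherry G * \sum_(n < M) n%:R * q n.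
  apply: le_trans HS; rewrite mulr_sumr -sumrB le_eqVlt; apply/orP; left.
  by apply/eqP/eq_bigr => n _; rewrite steinE; ring.
have w_le n : q n * mean_edges G n (fun m => f m.+1) <= q n * C.
  rewrite ler_wpM2l ?poisson_pmf_ge0// -(mean_edges_cst G n C).
  exact: le_mean_edges.
have F2 : \sum_(n < M.+2) q n = \sum_(n < M) q n + (q M + q M.+1).
  by rewrite !big_ord_recr /= addrA.
have F2_le1 := sum_poisson_pmf_le1 s_gt0 M.+2; rewrite -/(q _) in F2_le1.
have L1 : al * (q M * mean_edges G M (fun m => f m.+1)
    + q M.+1 * mean_edges G M.+1 (fun m => f m.+1)) <=
    al * C * (1 - \sum_(n < M) q n).
  rewrite -mulrA ler_wpM2l ?(ltW al_gt0)//.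
  apply: le_trans (lerD (w_le M) (w_le M.+1)) _.
  by rewrite -mulrDl mulrC ler_wpM2l// lerBrDl -F2.
have L2 : s ^+ 2 * K * mean_cherry G * \sum_(n < M) n%:R * q n <=
    K * (s ^+ 3 * mean_cherry G).
  have -> : K * (s ^+ 3 * mean_cherry G) = s ^+ 2 * K * mean_cherry G * s by ring.
  apply: ler_wpM2l (sum_nat_poisson_le M).
  exact: mulr_ge0 (mulr_ge0 (sqr_ge0 s) K0) beta0.
(* [c] is at least [c] times the truncated mass, so replacing one by the other errs on the
   favourable side. *)
have L3 : 0 <= c * (1 - \sum_(n < M.+2) q n) by rewrite mulr_ge0// subr_ge0.
have L4 : 0 <= q M + q M.+1 by rewrite addr_ge0// poisson_pmf_ge0.
move: HP HS L3; rewrite F2; lra.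
Qed.

Lemma dTV_H2_le :
  (dTV (distribution P (H2 G)) (poisson_prob al 0) <=
   (min1V al * (s ^+ 3 * mean_cherry G))%:E)%E.
Proof.
have PE (A : set nat) : distribution P (H2 G) A = (fine (P (H2 G @^-1` A)))%:E.
  rewrite /distribution /pushforward fineK// fin_num_measure//.
  exact: measurable_funPTI.
have QE (A : set nat) : poisson_prob al 0 A = (fine (poisson_prob al 0 A))%:E.
  by rewrite fineK// fin_num_measure.
apply: ge_ereal_sup => _ [A _ <-].
suff : ((fine (P (H2 G @^-1` A)))%:E - (fine (poisson_prob al 0 A))%:E <=
    (min1V al * (s ^+ 3 * mean_cherry G))%:E)%E by rewrite -PE -QE.
rewrite -EFinB lee_fin.
have [al0|al_neq0] := eqVneq al 0; last first.
  apply: H2_prob_stein; rewrite lt_neqAle eq_sym al_neq0.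
  by rewrite mulr_ge0 ?mean_edge_ge0// divr_ge0// exprn_ge0// ltW.
have me0 : mean_edge G = 0.
  by move/eqP: al0; rewrite mulf_eq0 gt_eqF ?divr_gt0 ?exprn_gt0//= => /eqP.
rewrite al0 /min1V eqxx mul1r; apply: (@le_trans _ _ 0); last first.
  by rewrite mulr_ge0 ?mean_cherry_ge0// exprn_ge0// ltW.
(* At rate 0 the target is the Dirac mass at 0: the bound is trivial when 0 is in [A], and otherwise
   there is almost surely no edge. *)
rewrite subr_le0 /poisson_prob ltxx diracE.
have [A0|A0] := boolP (0%N \in A).
  rewrite -[leRHS]/(fine 1%E) fine_le ?fin_num_measure//; last first.
    by apply: probability_le1; exact: measurable_funPTI.
  exact: measurable_funPTI.
by apply: H2_prob0 => //; move: A0; rewrite notin_setE.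
Qed.

End stein_poisson.

Theorem theorem7p1 (R : realType)
    (d : measure_display) (T : measurableType d) (mu : probability T R)
    (s : R) (s_gt0 : 0 < s)
    (phi : T * T -> R) (phi_conn : connection_function phi)
    (dOm : measure_display) (Om : measurableType dOm) (P : probability Om R)
    (G : random_graph mu s phi P) :
  let alpha : R := fine 'E_P[fun w => (H2 G w)%:R] in
  (dTV (distribution P (H2 G)) (poisson_prob alpha 0)
   <= (min1V alpha)%:E *
      \int[mu]_x ((\int[mu]_y (phi (x, y) * s)%:E) ^+ 2 * s%:E))%E.
Proof.
rewrite /= expectation_H2// (integral_degree_sq G phi_conn) -EFinM.
exact: dTV_H2_le.
Qed.
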